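(* Let $\boldsymbol f_c\in L^2(0,T;H^{-1}(\Omega_c))$ and $f_d\in L^2(0,T;L^2(\Omega_d))$, and let $(\boldsymbol u_c^{n+1},p_c^{n+1};\boldsymbol u_f^{n_{k+1}},\phi_f^{n_{k+1}};\boldsymbol u_m^{n_{k+1}},\phi_m^{n_{k+1}})$ be the solution of the fully discrete decoupled modified characteristic scheme (Steps 1, 2, 3 of the context). Assume that $\hat C\Delta t<1$. Then the fluid velocity is stable in the first large time interval $[0,t_{n_1}]$: for any $0\le J\le r-1$, $$\begin{aligned} &\|\boldsymbol u_c^{J+1}\|_0^2+\frac{\nu\Delta t}{2}\sum_{n=0}^{J}\|\nabla\boldsymbol u_c^{n+1}\|_0^2+\frac{2\alpha\nu\Delta t}{\sqrt{k_f}}\sum_{n=0}^{J}\|P_\tau(\boldsymbol u_c^{n+1})\|_{L^2(\mathbb I)}^2\\ &+\frac{\gamma\Delta t}{\rho h}\sum_{n=0}^{J}\|(\boldsymbol u_c^{n+1}-\boldsymbol u_f^{0})\cdot\boldsymbol n_d\|_{L^2(\mathbb I)}^2+\frac{\gamma\Delta t}{\rho h}\sum_{n=0}^{J}\|\boldsymbol u_c^{n+1}\cdot\boldsymbol n_d\|_{L^2(\mathbb I)}^2\\ &\le C\bigg(\frac{2C_{PF}^2\Delta t}{\nu}\sum_{n=0}^{J}\|\boldsymbol f_c(t_{n+1})\|_{H^{-1}}^2+\frac{C_T^2\tilde C_{inv}^2C_{PF}\Delta t}{\rho^2\nu h}\sum_{n=0}^{J}\|\phi_f^{0}\|_0^2+\frac{\gamma\Delta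 t}{\rho h}\sum_{n=0}^{J}\|\boldsymbol u_f^{0}\cdot\boldsymbol n_d\|_{L^2(\mathbb I)}^2+\|\boldsymbol u_c^{0}\|_0^2\bigg). \end{aligned}$$ On the other hand, under the condition $$\gamma\ge\frac{4\tilde C_{inv}^2}{\eta_fC_{ft}}\bigg(\frac{\Delta t}{1-\Delta t-2\hat C\Delta t}\bigg),$$ the scheme is stable on the time interval $[0,t_{n_M}]$: $$\begin{aligned} &\|\boldsymbol u_c^{n_M}\|_0^2+\nu\Delta t\sum_{k=0}^{M-1}\sum_{n=n_k}^{n_{k+1}-1}\|\nabla\boldsymbol u_c^{n+1}\|_0^2+\frac{2\alpha\nu\Delta t}{\sqrt{k_f}}\sum_{k=0}^{M-1}\sum_{n=n_k}^{n_{k+1}-1}\|P_\tau(\boldsymbol u_c^{n+1})\|_{L^2(\mathbb I)}^2+\frac{2\mu\Delta s}{\rho k_m}\sum_{k=0}^{M-1}\|\boldsymbol u_m^{n_{k+1}}\|_0^2\\ &+\frac{\gamma\Delta t}{2\rho h}\sum_{k=0}^{M-1}\sum_{n=n_k}^{n_{k+1}-1}\|(\boldsymbol u_c^{n+1}-\boldsymbol u_f^{n_{k+1}})\cdot\boldsymbol n_d\|_{L^2(\mathbb I)}^2+\frac{\gamma\Delta s}{\rho h}\|\boldsymbol u_f^{n_M}\cdot\boldsymbol n_d\|_{L^2(\mathbb I)}^2+\frac{2\mu\Delta s}{\rho k_f}\sum_{k=0}^{M-1}\|\boldsymbol u_f^{n_{k+1}}\|_0^2\\ &+\frac{\eta_mC_{mt}}{\rho}\bigg(\|\phi_m^{n_M}\|_0^2+\sum_{k=0}^{M-1}\|\phi_m^{n_{k+1}}-\phi_m^{n_k}\|_0^2\bigg)+\frac{\eta_fC_{ft}}{\rho}\bigg(\|\phi_f^{n_M}\|_0^2+\sum_{k=0}^{M-1}\|\phi_f^{n_{k+1}}-\phi_f^{n_k}\|_0^2\bigg)\\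 &+\frac{\sigma k_m\Delta s}{\rho\mu}\bigg(\|\phi_m^{n_M}\|_0^2+\sum_{k=0}^{M-1}\|\phi_m^{n_{k+1}}-\phi_f^{n_k}\|_0^2+\|\phi_f^{n_M}\|_0^2+\sum_{k=0}^{M-1}\|\phi_f^{n_{k+1}}-\phi_m^{n_k}\|_0^2\bigg)\\ &\le C\bigg(\frac{C_{PF}^2\Delta t}{\nu}\sum_{k=0}^{M-1}\sum_{n=n_k}^{n_{k+1}-1}\|\boldsymbol f_c(t_{n+1})\|_{H^{-1}}^2+\frac{2\Delta t}{\rho\eta_fC_{ft}}\sum_{k=0}^{M-1}\sum_{n=n_k}^{n_{k+1}-1}\|f_d(t_{n_{k+1}})\|_0^2+\frac{\gamma\Delta s}{\rho h}\|\boldsymbol u_f^0\cdot\boldsymbol n_d\|_{L^2(\mathbb I)}^2\\ &\qquad+\|\boldsymbol u_c^0\|_0^2+\frac{\eta_mC_{mt}}{\rho}\|\phi_m^0\|_0^2+\frac{\eta_fC_{ft}}{\rho}\|\phi_f^0\|_0^2+\frac{\sigma k_m\Delta s}{\rho\mu}(\|\phi_m^0\|_0^2+\|\phi_f^0\|_0^2)\bigg). \end{aligned}$$ Here $C>0$ is a generic constant independent of $h$ and $\Delta t$.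
   Context: **Domain and parameters.** $\Omega=\Omega_c\cup\Omega_d\subset\mathbb R^D$, $D=2,3$, where $\Omega_c$ (conduit) and $\Omega_d$ (dual-porosity region) are disjoint bounded open convex regions with common interface $\mathbb I=\overline\Omega_c\cap\overline\Omega_d$; the boundaries $\partial\Omega_c\setminus\mathbb I$, $\partial\Omega_d\setminus\mathbb I$ are smooth enough and Lipschitz. $\boldsymbol n_d$ is the unit normal on $\mathbb I$ pointing from $\Omega_d$ to $\Omega_c$, $\boldsymbol n_c=-\boldsymbol n_d$, and $\boldsymbol\tau_i$ ($1\le i\le D-1$) are mutually orthogonal unit tangential vectors on $\mathbb I$. $P_\tau$ is the tangential projection on $\mathbb I$, $P_\tau(\boldsymbol v)=\sum_{i=1}^{D-1}(\boldsymbol v\cdot\boldsymbol\tau_i)\boldsymbol\tau_i$. The constants $\nu,\mu,\sigma,\alpha,\rho,\eta_f,\eta_m,C_{ft},C_{mt},k_f,k_m$ are positive physical parameters, $\gamma>0$ is a penalty parameter, $\Pi=k_f\mathrm I$ (so $\mathrm{trace}(\Pi)=Dk_f$). $\boldsymbol f_c$ is the body force in $\Omega_c$ and $f_d$ the source in $\Omega_d$. $\|\cdot\|_0$ is the $L^2$ norm and $(\cdot,\cdot)_{\Omega_\Lambda}$ the $L^2(\Omega_\Lambda)$ inner product, $\Lambda=c,d$. **Spaces.** $Y_c=\{\boldsymbol v\in H^1(\Omega_c)^D:\boldsymbol v=0\text{ on }\partial\Omega_c\setminus\mathbb I\}$, $Q_c=L^2_0(\Omega_c)$ (mean-zero $L^2$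 functions), $Y_f=\{\boldsymbol v\in H(\mathrm{div},\Omega_d):\boldsymbol v\cdot\boldsymbol n_d=0\text{ on }\partial\Omega_d\setminus\mathbb I\}$, $Q_f=L^2_0(\Omega_d)$, $Y_m=\{\boldsymbol v\in H(\mathrm{div},\Omega_d):\boldsymbol v\cdot\boldsymbol n_d=0\text{ on }\partial\Omega_d\}$, $Q_m=L^2_0(\Omega_d)$; $\mathcal X=Y_c\times Q_c\times Y_f\times Q_f\times Y_m\times Q_m$. $T_h$ is a uniform simplicial partition of $\overline\Omega_c\cup\overline\Omega_d$ of mesh size $h$ (maximal element diameter), matching along $\mathbb I$. Finite element spaces $Y_c^h\subset Y_c$, $Q_c^h\subset Q_c$, $Y_f^h\subset Y_f$, $Q_f^h\subset Q_f$, $Y_m^h\subset Y_m$, $Q_m^h\subset Q_m$ satisfy inf-sup conditions with constants $\chi_c$ (independent of $h$), $\chi_f,\chi_m>0$: $\inf_{0\ne q\in Q_c^h}\sup_{0\ne\boldsymbol v\in Y_c^h}\frac{(q,\nabla\cdot\boldsymbol v)_{\Omega_c}}{\|\nabla\boldsymbol v\|_0\|q\|_0}\ge\chi_c$, and, for $i=f,m$ and all $\psi\in Q_i^h$, $\sup_{0\ne\boldsymbol v\in Y_i^h}\frac{(\psi,\nabla\cdot\boldsymbol v)_{\Omega_d}}{\|\boldsymbol v\|_{H(\mathrm{div},\Omega_d)}}\ge\chi_i\|\psi\|_0$. $\mathcal X^h=Y_c^h\times Q_c^h\times Y_f^h\times Q_f^h\times Y_m^h\times Q_m^h$, and $P^h:\mathcal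 X\to\mathcal X^h$ is a bounded linear projection operator (applied componentwise). **Time grids.** $\Delta t=T/N$, $t_n=n\Delta t$ ($0\le n\le N$) in $\Omega_c$; $\Delta s=T/M$, $t_{n_k}=k\Delta s$ ($0\le k\le M$) in $\Omega_d$; $N=rM$ with integer $r=\Delta s/\Delta t$, so $n_k=kr$. **Scheme.** Let $\boldsymbol u_c^0=P^h\boldsymbol u_{c0}$, $\phi_m^0=P^h\phi_{m0}$, $\phi_f^0=P^h\phi_{f0}$, where $\boldsymbol u_{c0},\phi_{m0},\phi_{f0}$ are the initial data, and let $\boldsymbol u_f^0\in Y_f^h$ be the initial microfracture velocity. For $k=0,\dots,M-1$ and $n=n_k,\dots,n_{k+1}-1$ find $(\boldsymbol u_c^{n+1},p_c^{n+1};\boldsymbol u_f^{n_{k+1}},\phi_f^{n_{k+1}};\boldsymbol u_m^{n_{k+1}},\phi_m^{n_{k+1}})\in\mathcal X^h$ such that for all $(\boldsymbol v_c^h,q^h;\boldsymbol v_f^h,\psi_f^h;\boldsymbol v_m^h,\psi_m^h)\in\mathcal X^h$: Step 1: $$\begin{aligned}&\Big(\tfrac{\boldsymbol u_c^{n+1}-\boldsymbol u_c^n}{\Delta t},\boldsymbol v_c^h\Big)_{\Omega_c}+a_{\Omega_c}(\boldsymbol u_c^{n+1},\boldsymbol v_c^h)-b(\boldsymbol v_c^h,p_c^{n+1})+b(\boldsymbol u_c^{n+1},q^h)-\tfrac1\rho\int_{\mathbb I}\phi_f^{n_k}\boldsymbol v_c^h\cdot\boldsymbol n_d\,ds\\&+\tfrac{\gamma}{\rho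 h}\int_{\mathbb I}((\boldsymbol u_c^{n+1}-\boldsymbol u_f^{n_k})\cdot\boldsymbol n_d)(\boldsymbol v_c^h\cdot\boldsymbol n_d)\,ds=(\boldsymbol f_c(t_{n+1}),\boldsymbol v_c^h)_{\Omega_c}-\Big(\tfrac{\boldsymbol u_c^n-\hat{\boldsymbol u}_c^n}{\Delta t},\boldsymbol v_c^h\Big)_{\Omega_c},\end{aligned}$$ where $\hat{\boldsymbol u}_c^n(x)=\boldsymbol u_c^n(x-\boldsymbol u_c^n(x)\Delta t)$, $b(\boldsymbol v,p)=(p,\nabla\cdot\boldsymbol v)_{\Omega_c}$ and $a_{\Omega_c}(\boldsymbol u,\boldsymbol v)=\nu(\nabla\boldsymbol u,\nabla\boldsymbol v)_{\Omega_c}+\sum_{i=1}^{D-1}\int_{\mathbb I}\frac{\alpha\nu\sqrt D}{\sqrt{\mathrm{trace}(\Pi)}}(\boldsymbol u\cdot\boldsymbol\tau_i)(\boldsymbol v\cdot\boldsymbol\tau_i)\,ds$. Step 2: $$\begin{aligned}&\tfrac{\eta_mC_{mt}}{\rho}\Big(\tfrac{\phi_m^{n_{k+1}}-\phi_m^{n_k}}{\Delta s},\psi_m^h\Big)_{\Omega_d}+\tfrac1\rho(\nabla\cdot\boldsymbol u_m^{n_{k+1}},\psi_m^h)_{\Omega_d}+\tfrac1\rho(\mu k_m^{-1}\boldsymbol u_m^{n_{k+1}},\boldsymbol v_m^h)_{\Omega_d}\\&-\tfrac1\rho(\phi_m^{n_{k+1}},\nabla\cdot\boldsymbol v_m^h)_{\Omega_d}+\tfrac{\sigma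 k_m}{\rho\mu}(\phi_m^{n_{k+1}}-\phi_f^{n_k},\psi_m^h)_{\Omega_d}=0.\end{aligned}$$ Step 3: $$\begin{aligned}&\tfrac{\eta_fC_{ft}}{\rho}\Big(\tfrac{\phi_f^{n_{k+1}}-\phi_f^{n_k}}{\Delta s},\psi_f^h\Big)_{\Omega_d}+\tfrac1\rho(\nabla\cdot\boldsymbol u_f^{n_{k+1}},\psi_f^h)_{\Omega_d}+\tfrac1\rho(\mu k_f^{-1}\boldsymbol u_f^{n_{k+1}},\boldsymbol v_f^h)_{\Omega_d}-\tfrac1\rho(\phi_f^{n_{k+1}},\nabla\cdot\boldsymbol v_f^h)_{\Omega_d}\\&+\tfrac{\sigma k_m}{\rho\mu}(\phi_f^{n_{k+1}}-\phi_m^{n_k},\psi_f^h)_{\Omega_d}+\tfrac1\rho\int_{\mathbb I}\phi_f^{n_k}\boldsymbol v_f^h\cdot\boldsymbol n_d\,ds-\tfrac{\gamma}{\rho h}\int_{\mathbb I}((S^{n_{k+1}}-\boldsymbol u_f^{n_{k+1}})\cdot\boldsymbol n_d)(\boldsymbol v_f^h\cdot\boldsymbol n_d)\,ds=\tfrac1\rho(f_d(t_{n_{k+1}}),\psi_f^h)_{\Omega_d},\end{aligned}$$ where $S^{n_{k+1}}=\frac1r\sum_{n=n_k}^{n_{k+1}-1}\boldsymbol u_c^{n+1}$. **Constants.** $C_{PF}$: Poincaré–Friedrichs constant, $\|\boldsymbol v\|_0\le C_{PF}\|\nabla\boldsymbol v\|_0$ for $\boldsymbol v\in Y_c$. $C_T$: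 trace constant, $\|\boldsymbol v\|_{L^2(\mathbb I)}\le C_T\|\boldsymbol v\|_0^{1/2}\|\nabla\boldsymbol v\|_0^{1/2}$ for $\boldsymbol v\in Y_c$. $\tilde C_{inv}$: trace inverse constant, $\|\psi\|_{L^2(\mathbb I)}\le\tilde C_{inv}h^{-1/2}\|\psi\|_0$ for $\psi\in Q_f^h$. $\hat C$: a constant independent of $h$ and $\Delta t$ with $(\hat{\boldsymbol u}_c^n,\hat{\boldsymbol u}_c^n)_{\Omega_c}-(\boldsymbol u_c^n,\boldsymbol u_c^n)_{\Omega_c}\le\hat C\Delta t(\boldsymbol u_c^n,\boldsymbol u_c^n)_{\Omega_c}$ (the paper takes this from the literature, assuming $\boldsymbol u_c^n\in W^{1,\infty}$). *)

(* Defs.v *)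
From HB Require Import structures.
From mathcomp Require Import all_boot all_order all_algebra.
From mathcomp Require Import all_classical all_reals all_analysis.
From mathcomp Require Import measurable_realfun.

Set Implicit Arguments.
Unset Strict Implicit.
Unset Printing Implicit Defensive.

Import Order.TTheory GRing.Theory Num.Theory.
Import numFieldNormedType.Exports.

Local Open Scope classical_set_scope.
Local Open Scope ring_scope.

HB.instance Definition _ (R : realType) (m n : nat) :=
  @isMeasurable.Build default_measure_display 'M[R]_(m, n)
    <<s @open 'M[R]_(m, n) >>
    (@sigma_algebra0 _ _ _) (@sigma_algebraC _ _)
    (@sigma_algebra_bigcup _ _ _).

Section borel_matrix.
Variable R : realType.

Definition rational_box n (p : 'rV[rat]_n * nat) : set 'rV[R]_n :=
  [set x | forall i, `|x 0 i - ratr (p.1 0 i)| < p.2.+1%:R^-1].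

Lemma open_rational_boxes n (U : set 'rV[R]_n) : open U ->
  U = \bigcup_(p in [set p | rational_box p `<=` U]) rational_box p.
Proof.
move=> oU; apply/seteqP; split; last by move=> x [p /= pU xp]; exact: pU.
move=> x Ux.
have /nbhs_ballP[e /= e0 eU] : nbhs x U by exact: open_nbhs_nbhs.
have [k ke] : exists k : nat, k.+1%:R^-1 < e / 2.
  have := @near_infty_natSinv_lt R (PosNum (divr_gt0 e0 (ltr0Sn R 1))).
  by case=> k _ /(_ k (leqnn k)) ?; exists k.
have /choice[q hq] (i : 'I_n) :
    exists q : rat, `|x 0 i - ratr q| < k.+1%:R^-1 :> R.
  have [|q] := @rat_in_itvoo R (x 0 i - k.+1%:R^-1) (x 0 i + k.+1%:R^-1).
    by rewrite ltrBlDr -addrA ltrDl addr_gt0// invr_gt0.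
  rewrite in_itv/= => /andP[q1 q2]; exists q.
  by rewrite distrC ltr_distl q1.
exists (\row_i q i, k) => /=; last by move=> i; rewrite mxE; exact: hq.
move=> y /= hy; apply: eU; split => // i j; rewrite ord1 /ball/=.
rewrite (splitr e) (le_lt_trans (ler_distD (ratr (q j)) _ _))// ltrD//.
  exact: (lt_trans (hq j)).
by rewrite distrC; apply: lt_trans ke; have := hy j; rewrite mxE.
Qed.

Lemma measurable_row d (T : measurableType d) n (f : 'I_n -> T -> R) :
  (forall i, measurable_fun setT (f i)) ->
  measurable_fun setT (fun t => \row_(i < n) f i t : 'rV[R]_n).
Proof.
move=> mf; apply: (@measurability _ _ _ _ _ _ (@open 'rV[R]_n)) => //.
move=> _ [U oU <-]; rewrite setTI (open_rational_boxes oU) preimage_bigcup.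
rewrite bigcup_mkcond; apply: countable_bigcupT_measurable => [|[q k]].
  exact: countableP.
case: ifP => // _.
have -> : (fun t => \row_(i < n) f i t : 'rV[R]_n) @^-1` rational_box (q, k) =
    \bigcap_(i in [set: 'I_n]) (f i @^-1` ball (ratr (q 0 i) : R) k.+1%:R^-1).
  apply/seteqP; split=> t /= h => [i _|i]; have := h i;
    rewrite /ball/= mxE distrC//.
  exact.
apply: fin_bigcap_measurable => // i _; rewrite -[X in measurable X]setTI.
by apply: mf => //; exact: measurable_ball.
Qed.

Lemma continuous_measurable_mx m n p q (f : 'M[R]_(m, n) -> 'M[R]_(p, q)) :
  continuous f -> measurable_fun setT f.
Proof.
move=> cf; apply: (@measurability _ _ _ _ _ _ (@open 'M[R]_(p, q))) => //.
move=> _ [U oU <-]; rewrite setTI; apply: sub_sigma_algebra.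
exact: open_comp.
Qed.

Lemma measurable_coord m n i j :
  measurable_fun setT (fun x : 'M[R]_(m, n) => x i j : measurableTypeR R).
Proof.
apply: (measurability _ (RGenOpens.measurableE R)) => _ [_ [a [b ->]] <-].
rewrite setTI; apply: sub_sigma_algebra.
apply: open_comp; last exact: interval_open.
by move=> x _; exact: coord_continuous.
Qed.

Definition rV_snoc n (p : 'rV[R]_n * measurableTypeR R) : 'rV[R]_n.+1 :=
  \row_(i < n.+1) oapp (p.1 0) p.2 (unlift ord_max i).

Lemma measurable_rV_snoc n : measurable_fun setT (@rV_snoc n).
Proof.
suff h i : measurable_fun setT (fun p : 'rV[R]_n * measurableTypeR R =>
    oapp (p.1 0) p.2 (unlift (ord_max : 'I_n.+1) i) : measurableTypeR R).
  have := @measurable_row _ ('rV[R]_n * measurableTypeR R)%type n.+1 _ h.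
  exact.
case: unliftP => [j|] _ /=; last exact: measurable_snd.
exact: (measurableT_comp (measurable_coord 0 j)
  (@measurable_fst _ _ 'rV[R]_n (measurableTypeR R))).
Qed.

Lemma measurable_affine m n (a : 'rV[R]_n) (B : 'M[R]_(m, n)) :
  measurable_fun setT (fun s : 'rV[R]_m => a + s *m B).
Proof.
have -> : (fun s => a + s *m B) =
    (fun s => \row_j (a 0 j + \sum_(i < m) s 0 i * B i j)).
  by apply/funext => s; apply/rowP => j; rewrite !mxE.
apply: (@measurable_row _ 'rV[R]_m n
  (fun j s => a 0 j + \sum_(i < m) s 0 i * B i j)) => j.
apply: measurable_funD => //; apply: measurable_sum => i.
by apply: measurable_funM => //; exact: measurable_coord.
Qed.

End borel_matrix.

Definition image_measure d d' (T : measurableType d) (T' : measurableType d')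
    (R : realType) (mu : {measure set T -> \bar R}) (f : T -> T')
    (mf : measurable_fun setT f) : {measure set T' -> \bar R} :=
  measure_function_pushforward__canonical__measure_function_Measure mu mf.

(* n-dimensional Lebesgue measure, as an iterated product measure. *)
Fixpoint lebesgue_rV (R : realType) n : {measure set 'rV[R]_n -> \bar R} :=
  match n with
  | 0 => dirac (0 : 'rV[R]_0)
  | n'.+1 => image_measure
      (lebesgue_rV R n' \x (@lebesgue_measure R))%E (@measurable_rV_snoc R n')
  end.

Definition mdot (R : realType) m n (A B : 'M[R]_(m, n)) : R :=
  \sum_i \sum_j A i j * B i j.

Definition enorm (R : realType) m n (A : 'M[R]_(m, n)) : R :=
  Num.sqrt (mdot A A).

Section L2.
Context d (T : measurableType d) (R : realType).
Variables (mu : {measure set T -> \bar R}) (A : set T).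

Definition L2 (f : T -> R) :=
  measurable_fun A f /\ (\int[mu]_(x in A) (f x ^+ 2)%:E < +oo)%E.

Definition L2mx m n (F : T -> 'M[R]_(m, n)) :=
  forall i j, L2 (fun x => F x i j).

Definition ip (f g : T -> R) : R := \int[mu]_(x in A) (f x * g x).

Definition ipmx m n (F G : T -> 'M[R]_(m, n)) : R :=
  \int[mu]_(x in A) mdot (F x) (G x).

Definition L2norm (f : T -> R) : R := Num.sqrt (ip f f).

Definition L2normmx m n (F : T -> 'M[R]_(m, n)) : R := Num.sqrt (ipmx F F).

Definition L2cvg m n (W : nat -> T -> 'M[R]_(m, n)) (F : T -> 'M[R]_(m, n)) :=
  (fun k => \int[mu]_(x in A)
     (mdot (W k x - F x) (W k x - F x))%:E)%E @ \oo --> 0%E.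

End L2.

Section calculus.
Variables (R : realType) (D : nat).
Implicit Types (psi q : 'rV[R]_D -> R) (v w : 'rV[R]_D -> 'rV[R]_D).

Definition pderiv (j : 'I_D) psi : 'rV[R]_D -> R :=
  fun x => 'D_(delta_mx 0 j) psi x.

Definition gradient psi (x : 'rV[R]_D) : 'rV[R]_D := \row_j pderiv j psi x.

Definition jacobian w (x : 'rV[R]_D) : 'M[R]_D :=
  \matrix_(i, j) pderiv j (fun y => w y 0 i) x.

Definition smooth psi :=
  forall (s : seq 'I_D) x, differentiable (foldr pderiv psi s) x.

Definition support psi := closure [set x | psi x != 0].

Definition test_function psi := smooth psi /\ compact (support psi).

Definition weak_gradient (Om : set 'rV[R]_D) v (G : 'rV[R]_D -> 'M[R]_D) :=
  forall psi, test_function psi -> support psi `<=` Om -> forall i j,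
  \int[lebesgue_rV R D]_(x in Om) (v x 0 i * pderiv j psi x) =
  - \int[lebesgue_rV R D]_(x in Om) (G x i j * psi x).

Definition weak_divergence (Om : set 'rV[R]_D) v q :=
  forall psi, test_function psi -> support psi `<=` Om ->
  \int[lebesgue_rV R D]_(x in Om) mdot (v x) (gradient psi x) =
  - \int[lebesgue_rV R D]_(x in Om) (q x * psi x).

(* Green's formula: the value at psi of the normal trace functional of v. *)
Definition normal_trace (Om : set 'rV[R]_D) v q psi : R :=
  \int[lebesgue_rV R D]_(x in Om) (mdot (v x) (gradient psi x) + q x * psi x).

Definition polynomial_fun psi :=
  exists s : seq (R * ('I_D -> nat)),
  forall x, psi x = \sum_(m <- s) m.1 * \prod_i x 0 i ^+ m.2 i.

End calculus.

(* The dimension of the space is d.+1.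

   The interface of two disjoint open convex sets lies in a hyperplane, so the
   unit normal n_d and the orthonormal tangent vectors (the rows of tau) are
   constant; xI is any point of the interface. *)
Record geometry (R : realType) (d : nat) := Geometry {
  Omc : set 'rV[R]_d.+1;
  Omd : set 'rV[R]_d.+1;
  xI : 'rV[R]_d.+1;
  nd : 'rV[R]_d.+1;
  tau : 'M[R]_(d, d.+1) }.

Record params (R : realType) := Params {
  nu : R; mu : R; sigma : R; alpha : R; rho : R; etaf : R; etam : R;
  Cft : R; Cmt : R; kf : R; km : R; gamma : R }.

Definition positive_params (R : realType) (P : params R) :=
  [/\ 0 < nu P, 0 < mu P, 0 < sigma P, 0 < alpha P & 0 < rho P] /\
  [/\ 0 < etaf P, 0 < etam P, 0 < Cft P & 0 < Cmt P] /\
  [/\ 0 < kf P, 0 < km P & 0 < gamma P].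

Section spaces.
Variables (R : realType) (d : nat) (g : geometry R d).
Local Notation D := d.+1.
Local Notation X := 'rV[R]_D.

Definition interface : set X := closure (Omc g) `&` closure (Omd g).

Record is_geometry : Prop := IsGeometry {
  Omc_open : open (Omc g);
  Omd_open : open (Omd g);
  Omc_bounded : bounded_set (Omc g);
  Omd_bounded : bounded_set (Omd g);
  Omc_convex : convex_set (Omc g);
  Omd_convex : convex_set (Omd g);
  Omc_nonempty : Omc g !=set0;
  Omd_nonempty : Omd g !=set0;
  Om_disjoint : Omc g `&` Omd g = set0;
  xI_interface : interface (xI g);
  nd_unit : mdot (nd g) (nd g) = 1;
  nd_Omc : forall x, Omc g x -> 0 < mdot (x - xI g) (nd g);
  nd_Omd : forall x, Omd g x -> mdot (x - xI g) (nd g) < 0;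
  tau_orthonormal : tau g *m (tau g)^T = 1%:M;
  tau_tangent : nd g *m (tau g)^T = 0 }.

(* Surface measure of the hyperplane containing the interface. *)
Definition surface : {measure set X -> \bar R} :=
  image_measure (lebesgue_rV R d) (@measurable_affine R d D (xI g) (tau g)).

Definition Ptau (v : X) : X :=
  \sum_(i < d) mdot v (row i (tau g)) *: row i (tau g).

Local Notation leb := (lebesgue_rV R D).

(* Weak derivatives are carried along with the functions: an element of
   H^1(Omega_c)^D is a pair (v, grad v) and an element of H(div, Omega_d) is a
   pair (v, div v). The value on the interface of a function of Y_c or of a
   finite element function is its trace. *)
Definition H1fun := ((X -> X) * (X -> 'M[R]_D))%type.
Definition Hdivfun := ((X -> X) * (X -> R))%type.

Definition div1 (v : H1fun) : X -> R := fun x => \tr (v.2 x).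

Definition H1norm (v : H1fun) : R :=
  Num.sqrt (L2normmx leb (Omc g) v.1 ^+ 2 + L2normmx leb (Omc g) v.2 ^+ 2).

Definition Hdivnorm (v : Hdivfun) : R :=
  Num.sqrt (L2normmx leb (Omd g) v.1 ^+ 2 + L2norm leb (Omd g) v.2 ^+ 2).

(* The last clause says that v vanishes on the rest of the boundary and that
   its trace on the interface is the restriction of v.1: v is the limit in H^1
   of smooth functions vanishing near the rest of the boundary, whose
   restrictions to the interface tend to v.1. *)
Definition Yc : set H1fun := [set v |
  [/\ L2mx leb (Omc g) v.1, L2mx leb (Omc g) v.2,
      weak_gradient (Omc g) v.1 v.2, L2mx surface interface v.1 &
      exists w : nat -> X -> X,
      [/\ forall k i, smooth (fun x => w k x 0 i),
          forall k x, ((closure (Omc g) `\` Omc g) `\` interface) x ->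
            \forall y \near x, w k y = 0,
          L2cvg leb (Omc g) w v.1,
          L2cvg leb (Omc g) (fun k => jacobian (w k)) v.2 &
          L2cvg surface interface w v.1]]].

Definition Hdiv : set Hdivfun := [set v |
  [/\ L2mx leb (Omd g) v.1, L2 leb (Omd g) v.2 &
      weak_divergence (Omd g) v.1 v.2]].

Definition Yf : set Hdivfun := [set v | Hdiv v /\
  forall psi, test_function psi -> support psi `&` interface = set0 ->
    normal_trace (Omd g) v.1 v.2 psi = 0].

Definition Ym : set Hdivfun := [set v | Hdiv v /\
  forall psi, test_function psi -> normal_trace (Omd g) v.1 v.2 psi = 0].

Definition L20 (Om : set X) : set (X -> R) :=
  [set q | L2 leb Om q /\ \int[leb]_(x in Om) q x = 0].

Definition poincare_friedrichs (CPF : R) := forall v, Yc v ->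
  L2normmx leb (Omc g) v.1 <= CPF * L2normmx leb (Omc g) v.2.

Definition trace_inequality (CT : R) := forall v, Yc v ->
  L2normmx surface interface v.1 <=
  CT * Num.sqrt (L2normmx leb (Omc g) v.1) *
       Num.sqrt (L2normmx leb (Omc g) v.2).

(* f_c is paired with all of Y_c, so H^{-1}(Omega_c) is the dual of Y_c, normed
   by the H^1 norm, and not the dual of H^1_0. *)
Definition Hm1 (f : H1fun -> R) :=
  (forall a u v, Yc u -> Yc v -> f (a *: u + v) = a * f u + f v) /\
  exists K, forall v, Yc v -> `|f v| <= K * H1norm v.

Definition Hm1norm (f : H1fun -> R) : R :=
  sup [set `|f v| / H1norm v | v in [set v | Yc v /\ H1norm v != 0]].

Definition L2Hm1 (T : R) (f : R -> H1fun -> R) :=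
  [/\ forall t, `[0, T]%classic t -> Hm1 (f t),
      forall v, Yc v -> measurable_fun `[0, T] (fun t => f t v) &
      L2 (@lebesgue_measure R) `[0, T] (fun t => Hm1norm (f t))].

Definition L2L2 (T : R) (f : R -> X -> R) :=
  [/\ forall t, `[0, T]%classic t -> L2 leb (Omd g) (f t),
      forall q, L2 leb (Omd g) q ->
        measurable_fun `[0, T] (fun t => ip leb (Omd g) (f t) q) &
      L2 (@lebesgue_measure R) `[0, T] (fun t => L2norm leb (Omd g) (f t))].

End spaces.

Section finite_elements.
Variables (R : realType) (d : nat) (g : geometry R d).
Local Notation D := d.+1.
Local Notation X := 'rV[R]_D.
Local Notation leb := (lebesgue_rV R D).

(* A simplex is given by its vertices, the rows of a matrix. *)
Definition simplex := 'M[R]_(D.+1, D).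

Definition barycentric (l : 'rV[R]_D.+1) :=
  (forall i, 0 <= l 0 i) /\ \sum_i l 0 i = 1.

Definition hull (K : simplex) : set X :=
  [set x | exists l, barycentric l /\ x = l *m K].

Definition common_face (K L : simplex) : set X :=
  [set x | exists l, [/\ barycentric l, x = l *m K &
     forall i, l 0 i != 0 -> exists j, row i K = row j L]].

Definition nondegenerate (K : simplex) :=
  (row_mx (const_mx 1 : 'cV[R]_D.+1) K : 'M[R]_D.+1) \in unitmx.

(* Every simplex lies in one of the two subdomains and any two simplices meet
   in a common face (also across the interface); kappa is the
   quasi-uniformity constant. *)
Record is_mesh (kappa : R) (Th : seq simplex) (h : R) : Prop := IsMesh {
  mesh_size_gt0 : 0 < h;
  mesh_nondegenerate : forall K, K \in Th -> nondegenerate K;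
  mesh_cover : [set x | exists2 K, K \in Th & hull K x] =
    closure (Omc g) `|` closure (Omd g);
  mesh_subdomain : forall K, K \in Th ->
    hull K `<=` closure (Omc g) \/ hull K `<=` closure (Omd g);
  mesh_conforming : forall K L, K \in Th -> L \in Th ->
    hull K `&` hull L = common_face K L;
  mesh_diameter_le : forall K x y, K \in Th -> hull K x -> hull K y ->
    enorm (x - y) <= h;
  mesh_diameter_max : exists K x y,
    [/\ K \in Th, hull K x, hull K y & enorm (x - y) = h];
  mesh_quasi_uniform : forall K, K \in Th ->
    exists x, forall y, enorm (y - x) <= kappa * h -> hull K y }.

(* Discontinuous functions: on the interface, the value is the one-sided trace
   from Om. *)
Definition piecewise_polynomial (Om : set X) (Th : seq simplex) (q : X -> R) :=
  forall K, K \in Th -> hull K `<=` closure Om ->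
  exists p, [/\ polynomial_fun p, forall x, (hull K)° x -> q x = p x &
    {ae surface g, forall x, hull K x -> interface g x -> q x = p x}].

Definition continuous_piecewise_polynomial (Om : set X) (Th : seq simplex)
    (q : X -> R) :=
  forall K, K \in Th -> hull K `<=` closure Om ->
  exists p, polynomial_fun p /\ forall x, hull K x -> q x = p x.

Definition finite_dim_subspace (V : lmodType R) (Y : set V) :=
  exists n (b : 'I_n -> V),
  Y = [set v | exists c : 'I_n -> R, v = \sum_i c i *: b i].

Record fe_spaces := FESpaces {
  Ych : set (H1fun R d); Qch : set (X -> R);
  Yfh : set (Hdivfun R d); Qfh : set (X -> R);
  Ymh : set (Hdivfun R d); Qmh : set (X -> R) }.

Definition infsup_c (chi : R) (Y : set (H1fun R d)) (Q : set (X -> R)) :=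
  let Q0 := [set q | Q q /\ L2norm leb (Omc g) q != 0] in
  let Y0 := [set v | Y v /\ L2normmx leb (Omc g) v.2 != 0] in
  let quotient q v := ip leb (Omc g) q (div1 v) /
    (L2normmx leb (Omc g) v.2 * L2norm leb (Omc g) q) in
  (chi%:E <=
    ereal_inf [set ereal_sup [set (quotient q v)%:E | v in Y0] | q in Q0])%E.

Definition infsup_d (chi : R) (Y : set (Hdivfun R d)) (Q : set (X -> R)) :=
  let Y0 := [set v | Y v /\ Hdivnorm g v != 0] in
  let quotient psi v := ip leb (Omd g) psi v.2 / Hdivnorm g v in
  forall psi, Q psi ->
    ((chi * L2norm leb (Omd g) psi)%R%:E <=
      ereal_sup [set (quotient psi v)%:E | v in Y0])%E.

Definition fe_scalar (Om : set X) (Th : seq simplex) (Q : set (X -> R)) :=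
  [/\ Q `<=` L20 Om, @finite_dim_subspace (X -> R) Q &
      forall q, Q q -> piecewise_polynomial Om Th q].

Definition fe_Hdiv (Th : seq simplex) (Y0 Y : set (Hdivfun R d)) :=
  [/\ Y `<=` Y0, @finite_dim_subspace (Hdivfun R d) Y &
      forall v i, Y v -> piecewise_polynomial (Omd g) Th (fun x => v.1 x 0 i)].

Record is_fe_spaces (Th : seq simplex) (chic chif chim : R) (S : fe_spaces) :
    Prop := IsFESpaces {
  Ych_conforming : Ych S `<=` Yc g;
  Ych_finite_dim : @finite_dim_subspace (H1fun R d) (Ych S);
  Ych_polynomial : forall v i, Ych S v ->
    continuous_piecewise_polynomial (Omc g) Th (fun x => v.1 x 0 i);
  Qch_fe : fe_scalar (Omc g) Th (Qch S);
  Yfh_fe : fe_Hdiv Th (Yf g) (Yfh S);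
  Qfh_fe : fe_scalar (Omd g) Th (Qfh S);
  Ymh_fe : fe_Hdiv Th (Ym g) (Ymh S);
  Qmh_fe : fe_scalar (Omd g) Th (Qmh S);
  Yfh_trace_L2 : forall v, Yfh S v -> L2mx (surface g) (interface g) v.1;
  Qfh_trace_L2 : forall q, Qfh S q -> L2 (surface g) (interface g) q;
  Ych_infsup : infsup_c chic (Ych S) (Qch S);
  Yfh_infsup : infsup_d chif (Yfh S) (Qfh S);
  Ymh_infsup : infsup_d chim (Ymh S) (Qmh S) }.

Definition inverse_trace_inequality (Cinv h : R) (Q : set (X -> R)) :=
  forall psi, Q psi ->
  L2norm (surface g) (interface g) psi <=
  Cinv * (Num.sqrt h)^-1 * L2norm leb (Omd g) psi.

Definition bounded_projection (V : lmodType R) (nrm : V -> R) (Y Yh : set V)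
    (P : V -> V) :=
  [/\ forall v, Y v -> Yh (P v),
      forall a u v, Y u -> Y v -> P (a *: u + v) = a *: P u + P v,
      forall v, Yh v -> P v = v &
      exists K, forall v, Y v -> nrm (P v) <= K * nrm v].

Record projections := Projections {
  PYc : H1fun R d -> H1fun R d; PQc : (X -> R) -> X -> R;
  PYf : Hdivfun R d -> Hdivfun R d; PQf : (X -> R) -> X -> R;
  PYm : Hdivfun R d -> Hdivfun R d; PQm : (X -> R) -> X -> R }.

Record is_projections (S : fe_spaces) (Ph : projections) : Prop :=
  IsProjections {
  PYc_proj : @bounded_projection (H1fun R d) (H1norm g) (Yc g) (Ych S) (PYc Ph);
  PQc_proj : @bounded_projection (X -> R) (L2norm leb (Omc g))
    (L20 (Omc g)) (Qch S) (PQc Ph);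
  PYf_proj : @bounded_projection (Hdivfun R d) (Hdivnorm g)
    (Yf g) (Yfh S) (PYf Ph);
  PQf_proj : @bounded_projection (X -> R) (L2norm leb (Omd g))
    (L20 (Omd g)) (Qfh S) (PQf Ph);
  PYm_proj : @bounded_projection (Hdivfun R d) (Hdivnorm g)
    (Ym g) (Ymh S) (PYm Ph);
  PQm_proj : @bounded_projection (X -> R) (L2norm leb (Omd g))
    (L20 (Omd g)) (Qmh S) (PQm Ph) }.

End finite_elements.

Section scheme.
Variables (R : realType) (d : nat) (g : geometry R d) (P : params R).
Local Notation D := d.+1.
Local Notation X := 'rV[R]_D.
Local Notation leb := (lebesgue_rV R D).
Local Notation I := (interface g).

(* Where the foot x - dt u(x) leaves Omega_c and the interface, u is extended
   by zero. *)
Definition foot (dt : R) (u : X -> X) : X -> X := fun x =>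
  let y := x - dt *: u x in
  if y \in Omc g `|` I then u y else 0.

Definition characteristic_bound (Chat dt : R) (u : X -> X) :=
  (\int[leb]_(x in Omc g) (mdot (foot dt u x) (foot dt u x))%:E
   - \int[leb]_(x in Omc g) (mdot (u x) (u x))%:E
   <= (Chat * dt)%:E * \int[leb]_(x in Omc g) (mdot (u x) (u x))%:E)%E.

Definition a_c (u v : H1fun R d) : R :=
  nu P * ipmx leb (Omc g) u.2 v.2 +
  \sum_(i < d) \int[surface g]_(x in I)
    (alpha P * nu P * Num.sqrt D%:R / Num.sqrt (\tr ((kf P)%:M : 'M[R]_D)) *
     mdot (u.1 x) (row i (tau g)) * mdot (v.1 x) (row i (tau g))).

Definition b_c (v : H1fun R d) (p : X -> R) : R := ip leb (Omc g) p (div1 v).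

Definition step1 (S : fe_spaces R d) (h dt : R) (f : H1fun R d -> R)
    (u u' : H1fun R d) (p' : X -> R) (uf : Hdivfun R d) (phif : X -> R) :=
  forall v q, Ych S v -> Qch S q ->
  ipmx leb (Omc g) (fun x => dt^-1 *: (u'.1 x - u.1 x)) v.1
  + a_c u' v - b_c v p' + b_c u' q
  - (rho P)^-1 * \int[surface g]_(x in I) (phif x * mdot (v.1 x) (nd g))
  + gamma P / (rho P * h) * \int[surface g]_(x in I)
      (mdot (u'.1 x - uf.1 x) (nd g) * mdot (v.1 x) (nd g))
  = f v
    - ipmx leb (Omc g) (fun x => dt^-1 *: (u.1 x - foot dt u.1 x)) v.1.

Definition step2 (S : fe_spaces R d) (ds : R) (phif phim phim' : X -> R)
    (um' : Hdivfun R d) :=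
  forall v psi, Ymh S v -> Qmh S psi ->
  etam P * Cmt P / rho P *
    ip leb (Omd g) (fun x => ds^-1 * (phim' x - phim x)) psi
  + (rho P)^-1 * ip leb (Omd g) um'.2 psi
  + (rho P)^-1 * ipmx leb (Omd g) (fun x => (mu P / km P) *: um'.1 x) v.1
  - (rho P)^-1 * ip leb (Omd g) phim' v.2
  + sigma P * km P / (rho P * mu P) *
    ip leb (Omd g) (fun x => phim' x - phif x) psi
  = 0.

Definition step3 (S : fe_spaces R d) (h ds : R) (f : X -> R)
    (phif phim phif' : X -> R) (uf' : Hdivfun R d) (Sc : X -> X) :=
  forall v psi, Yfh S v -> Qfh S psi ->
  etaf P * Cft P / rho P *
    ip leb (Omd g) (fun x => ds^-1 * (phif' x - phif x)) psi
  + (rho P)^-1 * ip leb (Omd g) uf'.2 psi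
  + (rho P)^-1 * ipmx leb (Omd g) (fun x => (mu P / kf P) *: uf'.1 x) v.1
  - (rho P)^-1 * ip leb (Omd g) phif' v.2
  + sigma P * km P / (rho P * mu P) *
    ip leb (Omd g) (fun x => phif' x - phim x) psi
  + (rho P)^-1 * \int[surface g]_(x in I) (phif x * mdot (v.1 x) (nd g))
  - gamma P / (rho P * h) * \int[surface g]_(x in I)
      (mdot (Sc x - uf'.1 x) (nd g) * mdot (v.1 x) (nd g))
  = (rho P)^-1 * ip leb (Omd g) f psi.

(* uc n and pc n are taken at time n dt; uf k, phif k, um k and phim k at time
   k ds, that is at the fine index k r. *)
Record iterates := Iterates {
  uc : nat -> H1fun R d; pc : nat -> X -> R;
  uf : nat -> Hdivfun R d; phif : nat -> X -> R;
  um : nat -> Hdivfun R d; phim : nat -> X -> R }.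

Record is_solution (S : fe_spaces R d) (h dt ds : R) (M r : nat)
    (fc : R -> H1fun R d -> R) (fd : R -> X -> R) (w : iterates) : Prop :=
  IsSolution {
  solution_c : forall k n, (k < M)%N -> (k * r <= n < k.+1 * r)%N ->
    [/\ Ych S (uc w n.+1), Qch S (pc w n.+1) &
        step1 S h dt (fc (n.+1%:R * dt)) (uc w n) (uc w n.+1) (pc w n.+1)
          (uf w k) (phif w k)];
  solution_m : forall k, (k < M)%N ->
    [/\ Ymh S (um w k.+1), Qmh S (phim w k.+1) &
        step2 S ds (phif w k) (phim w k) (phim w k.+1) (um w k.+1)];
  solution_f : forall k, (k < M)%N ->
    [/\ Yfh S (uf w k.+1), Qfh S (phif w k.+1) &
        step3 S h ds (fd (k.+1%:R * ds)) (phif w k) (phim w k) (phif w k.+1)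
          (uf w k.+1)
          (fun x => r%:R^-1 *:
             \sum_(k * r <= n < k.+1 * r) (uc w n.+1).1 x)] }.

Definition is_initial (S : fe_spaces R d) (Ph : projections R d)
    (uc0 : H1fun R d) (phim0 phif0 : X -> R) (w : iterates) :=
  [/\ uc w 0 = PYc Ph uc0, phim w 0 = PQm Ph phim0,
      phif w 0 = PQf Ph phif0 & Yfh S (uf w 0)].

Definition normc m n (F : X -> 'M[R]_(m, n)) : R := L2normmx leb (Omc g) F.
Definition normd (f : X -> R) : R := L2norm leb (Omd g) f.
Definition normdv (F : X -> X) : R := L2normmx leb (Omd g) F.
Definition normI (f : X -> R) : R := L2norm (surface g) I f.
Definition normIv (F : X -> X) : R := L2normmx (surface g) I F.

End scheme.

(* Main.v *)
Require Import Defs.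
From HB Require Import structures.
From mathcomp Require Import all_boot all_order all_algebra.
From mathcomp Require Import all_classical all_reals all_analysis.
From mathcomp Require Import measurable_realfun ring lra zify.

Set Implicit Arguments.
Unset Strict Implicit.
Unset Printing Implicit Defensive.

Import Order.TTheory GRing.Theory Num.Theory.
Import numFieldNormedType.Exports.

Local Open Scope classical_set_scope.
Local Open Scope ring_scope.

(** Both estimates are discrete energy estimates: the fine step is tested with
    the new velocity and pressure, the two coarse steps with their new velocity
    and pressure, so that all divergence terms cancel, and the identity
    2 (u - v, u) = |u|^2 - |v|^2 + |u - v|^2 produces telescoping squares
    ([step1_energy], [step2_energy], [step3_energy]). In the fine step the
    backward difference and the convection term combine to
    (u^(n+1) - hat u^n, u^(n+1)) / dt, so the characteristic bound gives a growth
    factor 1 + Chat dt per step; over [0, T] this costs at most exp (Chat T).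

    On the first coarse interval the interface datum is fixed. Its pairing with
    the velocity is absorbed by part of the viscosity, through the trace and
    Poincare-Friedrichs inequalities, and the discrete Gronwall lemma concludes
    ([first_interval]).

    On the whole interval, let a be the normal velocity of the conduit in a fine
    step, b and b' the old and new normal velocities of the microfractures. As
    the microfracture step uses the mean of the a's, the penalty terms of one
    coarse step add up to the sum of
      (a - b, a) - (a - b', b')
        = (|a - b|^2 + |a - b'|^2 + |b'|^2 - |b|^2) / 2,
    and the explicit pressure remains only as (phi, a - b'). The inverse trace
    inequality costs h^(-1/2), the penalty pays it back:
      (2 / rho) |(phi, a - b')|
        <= gamma / (2 rho h) |a - b'|^2 + 2 Cinv^2 / (rho gamma) |phi|^2,
    with a constant free of h. The remaining growth terms involve only
    quantities known at the beginning of the coarse step: the velocities inside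
    a coarse step are bounded by the energy at its beginning and the body force
    ([within_block]),
    and the source is paired with the old pressure plus an increment which the
    dissipation absorbs. Hence the energy grows by a factor 1 + rate ds per
    coarse step ([energy_growth]), and Gronwall's lemma over the coarse steps
    gives the bound ([whole_interval]). *)

(** * Semi-inner products *)

(** A positive semidefinite symmetric bilinear form [B] on the subspace [H] of
    [V]. Both [H] and [B] are total objects, as the square integrable
    representatives form a subspace of all functions, and an integral of
    products need not be additive outside [H]. *)
Record semi_inner (R : realType) (V : lmodType R) (H : set V)
    (B : V -> V -> R) : Prop := SemiInner {
  si_lin : forall a u v, H u -> H v -> H (a *: u + v);
  si_sym : forall u v, B u v = B v u;
  si_linl : forall a u v w, H u -> H v -> H w ->
    B (a *: u + v) w = a * B u w + B v w;
  si_ge0 : forall u, 0 <= B u u }.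

Section semi_inner_theory.
Variables (R : realType) (V : lmodType R) (H : set V) (B : V -> V -> R).
Hypothesis HB : semi_inner H B.
Implicit Types u v w : V.

Lemma siD u v : H u -> H v -> H (u + v).
Proof. by move=> Hu Hv; rewrite -[u]scale1r; exact: (si_lin HB). Qed.

Lemma siB u v : H u -> H v -> H (u - v).
Proof.
by move=> Hu Hv; rewrite addrC -scaleN1r; exact: (si_lin HB).
Qed.

Lemma si0 u : H u -> H 0.
Proof. by move=> Hu; rewrite -(subrr u); exact: siB. Qed.

Lemma siZ a u : H u -> H (a *: u).
Proof.
by move=> Hu; rewrite -[_ *: _]addr0; apply: (si_lin HB) => //; exact: si0 Hu.
Qed.

Lemma siDl u v w : H u -> H v -> H w -> B (u + v) w = B u w + B v w.
Proof.
by move=> Hu Hv Hw; rewrite -[u]scale1r (si_linl HB)// mul1r scale1r.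
Qed.

Lemma siBl u v w : H u -> H v -> H w -> B (u - v) w = B u w - B v w.
Proof.
by move=> Hu Hv Hw; rewrite addrC -scaleN1r (si_linl HB)// mulN1r addrC.
Qed.

Lemma siZl a u w : H u -> H w -> B (a *: u) w = a * B u w.
Proof.
move=> Hu Hw; have H0 : H 0 := si0 Hu.
have B0 : B 0 w = 0 by rewrite -(subrr u) siBl// subrr.
by rewrite -[_ *: _]addr0 (si_linl HB)// B0 addr0.
Qed.

Lemma si_sub u v : H u -> H v -> B (u - v) (u - v) = B u u - 2 * B u v + B v v.
Proof.
move=> Hu Hv; rewrite siBl ?(si_sym HB _ (u - v)) ?siBl//; try exact: siB.
by rewrite (si_sym HB v u); ring.
Qed.

Lemma si_polar u v : H u -> H v ->
  2 * B (u - v) u = B u u - B v v + B (u - v) (u - v).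
Proof.
by move=> Hu Hv; rewrite si_sub// siBl// (si_sym HB v u); ring.
Qed.

Lemma si_young e u v : 0 < e -> H u -> H v ->
  2 * B u v <= e * B u u + e^-1 * B v v.
Proof.
move=> e0 Hu Hv; have := si_ge0 HB (e *: u - v).
rewrite si_sub//; last exact: siZ.
rewrite siZl// ?(si_sym HB _ (e *: u)) ?siZl//; try exact: siZ.
move=> h; rewrite -(ler_pM2l e0) mulrDr [e * (e^-1 * _)]mulrA divff ?gt_eqF// mul1r; lra.
Qed.

End semi_inner_theory.

(** * Square integrable functions *)

Section L2_theory.
Context d (T : measurableType d) (R : realType).
Variables (mu : {measure set T -> \bar R}) (A : set T).
Hypothesis mA : measurable A.
Implicit Types f g : T -> R.

Lemma L2_integrable f g : L2 mu A f -> L2 mu A g ->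
  mu.-integrable A (EFin \o (fun x => f x * g x)).
Proof.
move=> [mf f2] [mg g2].
have mfg : measurable_fun A (fun x => f x ^+ 2 + g x ^+ 2).
  by apply: measurable_funD; exact: measurable_funX.
have i2 (k : T -> R) : measurable_fun A k ->
    (\int[mu]_(x in A) (k x ^+ 2)%:E < +oo)%E ->
    mu.-integrable A (EFin \o (fun x => k x ^+ 2)).
  move=> mk k2; apply/integrableP; split.
    by apply/measurable_EFinP; exact: measurable_funX.
  rewrite (eq_integral (fun x => (k x ^+ 2)%:E))// => x _ /=.
  by rewrite ger0_norm// sqr_ge0.
apply: (le_integrable mA) (integrableD mA (i2 _ mf f2) (i2 _ mg g2)).
  by apply/measurable_EFinP; exact: measurable_funM.
move=> x _ /=; rewrite lee_fin normrM (ger0_norm (addr_ge0 _ _)) ?sqr_ge0//.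
rewrite -(real_normK (num_real (f x))) -(real_normK (num_real (g x))).
have := sqr_ge0 (`|f x| - `|g x|); have := sqr_ge0 (`|f x| + `|g x|); nra.
Qed.

Lemma L2_lin a f g : L2 mu A f -> L2 mu A g -> L2 mu A (a *: f + g).
Proof.
move=> Lf Lg.
have mfg : measurable_fun A (a *: f + g).
  by apply: measurable_funD; [apply: measurable_funM => //; exact: Lf.1|exact: Lg.1].
split => //.
have if2 := L2_integrable Lf Lf; have ig2 := L2_integrable Lg Lg.
have ifg := L2_integrable Lf Lg.
have /integrableP[_] := integrableD mA (integrableD mA (integrableZl mA (a ^+ 2) if2)
  (integrableZl mA (2 * a) ifg)) ig2.
apply: le_lt_trans; rewrite le_eqVlt; apply/orP; left; apply/eqP.
apply: eq_integral => x _ /=.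
rewrite [(a *: f + g) x](_ : _ = a * f x + g x)//.
by rewrite ger0_norm; [congr (_%:E); ring|have := sqr_ge0 (a * f x + g x); nra].
Qed.

Lemma ip_semi_inner : semi_inner (L2 mu A : set (T -> R)) (ip mu A).
Proof.
split.
- exact: L2_lin.
- by move=> f g; apply: eq_Rintegral => x _; rewrite mulrC.
- move=> a f g k Lf Lg Lk; rewrite /ip.
  rewrite -(RintegralZl a mA (L2_integrable Lf Lk)) -RintegralD//.
  + by apply: eq_Rintegral => x _ /=; rewrite -[LHS]/((a * f x + g x) * k x); ring.
  + exact: (integrableZl mA a (L2_integrable Lf Lk)).
  + exact: L2_integrable.
- by move=> f; apply: Rintegral_ge0 => x _; rewrite -expr2 sqr_ge0.
Qed.

Lemma Rintegral_sum (I : Type) (s : seq I) (F : I -> T -> R) :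
  (forall i, mu.-integrable A (EFin \o F i)) ->
  \int[mu]_(x in A) (\sum_(i <- s) F i x) = \sum_(i <- s) \int[mu]_(x in A) F i x.
Proof.
move=> iF; elim: s => [|i s IHs].
  rewrite big_nil -[RHS](mul0r (\int[mu]_(x in A) 0)) -RintegralZl//.
    by apply: eq_Rintegral => x _; rewrite big_nil mul0r.
  exact: integrable0.
rewrite big_cons -IHs -RintegralD//.
  by apply: eq_Rintegral => x _; rewrite big_cons.
rewrite (_ : EFin \o _ = (fun x => \sum_(i <- s) (EFin \o F i) x)%E).
  by apply: integrable_sum => // j _; exact: iF.
by apply/funext => x /=; rewrite sumEFin.
Qed.

Lemma ipmxE m n (F G : T -> 'M[R]_(m, n)) : L2mx mu A F -> L2mx mu A G ->
  ipmx mu A F G = \sum_i \sum_j ip mu A (fun x => F x i j) (fun x => G x i j).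
Proof.
move=> LF LG; have ii i j := L2_integrable (LF i j) (LG i j).
rewrite /ipmx /mdot Rintegral_sum => [|i].
  by apply: eq_bigr => i _; rewrite Rintegral_sum.
rewrite (_ : EFin \o _ = (fun x =>
  \sum_j (EFin \o (fun x => F x i j * G x i j)%R) x)%E).
  by apply: integrable_sum => // j _; exact: ii.
by apply/funext => x /=; rewrite sumEFin.
Qed.

Lemma mdotC m n (a b : 'M[R]_(m, n)) : mdot a b = mdot b a.
Proof.
by apply: eq_bigr => i _; apply: eq_bigr => j _; rewrite mulrC.
Qed.

Lemma mdot_ge0 m n (a : 'M[R]_(m, n)) : 0 <= mdot a a.
Proof.
by apply: sumr_ge0 => i _; apply: sumr_ge0 => j _; rewrite -expr2 sqr_ge0.
Qed.

Lemma mdot_lin m n a (u v w : 'M[R]_(m, n)) :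
  mdot (a *: u + v) w = a * mdot u w + mdot v w.
Proof.
rewrite /mdot mulr_sumr -big_split; apply: eq_bigr => i _ /=.
rewrite mulr_sumr -big_split; apply: eq_bigr => j _ /=.
by rewrite !mxE; ring.
Qed.

Lemma ipmx_semi_inner m n :
  semi_inner (@L2mx _ _ _ mu A m n : set (T -> 'M[R]_(m, n))) (@ipmx _ _ _ mu A m n).
Proof.
have L a (F G : T -> 'M[R]_(m, n)) :
    L2mx mu A F -> L2mx mu A G -> L2mx mu A (a *: F + G).
  move=> LF LG i j; rewrite (_ : (fun x => _) =
    a *: (fun x => F x i j) + (fun x => G x i j)); first exact: L2_lin.
  by apply/funext => x; rewrite -[LHS]/((a *: F x + G x) i j) !mxE.
split => //.
- by move=> f g; apply: eq_Rintegral => x _; rewrite mdotC.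
- move=> a F G K LF LG LK; rewrite !ipmxE//; last exact: L.
  rewrite mulr_sumr -big_split; apply: eq_bigr => i _ /=.
  rewrite mulr_sumr -big_split; apply: eq_bigr => j _ /=.
  rewrite -(si_linl ip_semi_inner)//.
  by apply: eq_Rintegral => x _; congr (_ * _); rewrite !mxE.
- by move=> F; apply: Rintegral_ge0 => x _; exact: mdot_ge0.
Qed.

Lemma L2norm_sqr f : L2norm mu A f ^+ 2 = ip mu A f f.
Proof. by rewrite sqr_sqrtr// (si_ge0 ip_semi_inner). Qed.

Lemma L2normmx_sqr m n (F : T -> 'M[R]_(m, n)) :
  L2normmx mu A F ^+ 2 = ipmx mu A F F.
Proof. by rewrite sqr_sqrtr// (si_ge0 (ipmx_semi_inner _ _)). Qed.

End L2_theory.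

(** * The pointwise inner product *)

Section pointwise.
Variable R : realType.

Lemma mdot_semi_inner m n : semi_inner [set: 'M[R]_(m, n)] (@mdot R m n).
Proof.
split => //.
- by move=> u v; exact: mdotC.
- by move=> a u v w _ _ _; exact: mdot_lin.
- by move=> u; exact: mdot_ge0.
Qed.

Lemma mdotBl m n (u v w : 'M[R]_(m, n)) : mdot (u - v) w = mdot u w - mdot v w.
Proof. exact: (siBl (mdot_semi_inner m n)). Qed.

Lemma mdotZl m n a (u w : 'M[R]_(m, n)) : mdot (a *: u) w = a * mdot u w.
Proof. exact: (siZl (mdot_semi_inner m n)). Qed.

Lemma mdot_suml m n (I : Type) (s : seq I) (F : I -> 'M[R]_(m, n)) w :
  mdot (\sum_(i <- s) F i) w = \sum_(i <- s) mdot (F i) w.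
Proof.
elim: s => [|i s IHs].
  rewrite !big_nil; apply: big1 => i _; apply: big1 => j _.
  by rewrite mxE mul0r.
by rewrite !big_cons (siDl (mdot_semi_inner m n)) ?IHs.
Qed.

(* The distance of u to the line spanned by w is nonnegative. *)
Lemma mdot_unit_le m n (u w : 'M[R]_(m, n)) : mdot w w = 1 ->
  mdot u w ^+ 2 <= mdot u u.
Proof.
move=> w1; have := mdot_ge0 (u - mdot u w *: w).
rewrite (si_sub (mdot_semi_inner m n))// (mdotC u) !mdotZl (mdotC w (_ *: _)).
by rewrite mdotZl w1 (mdotC w u); lra.
Qed.

Lemma mdot_Ptau d (g : geometry R d) (v : 'rV[R]_d.+1) :
  tau g *m (tau g)^T = 1%:M ->
  mdot (Ptau g v) (Ptau g v) = \sum_(i < d) mdot v (row i (tau g)) ^+ 2.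
Proof.
move=> orth.
have dotE (i j : 'I_d) : mdot (row i (tau g)) (row j (tau g)) = (i == j)%:R.
  have := congr1 (fun A : 'M[R]_d => A i j) orth; rewrite !mxE => <-.
  by rewrite /mdot big_ord1; apply: eq_bigr => k _; rewrite !mxE.
have dotP i : mdot (Ptau g v) (row i (tau g)) = mdot v (row i (tau g)).
  rewrite /Ptau mdot_suml (bigD1 i)//= mdotZl dotE eqxx mulr1 big1 ?addr0//.
  by move=> j ji; rewrite mdotZl dotE (negPf ji) mulr0.
rewrite {1}/Ptau mdot_suml; apply: eq_bigr => i _.
by rewrite mdotZl (mdotC (row i _)) dotP expr2.
Qed.

End pointwise.

Section L2_mdot.
Context dd (T : measurableType dd) (R : realType).
Variables (mu : {measure set T -> \bar R}) (A : set T).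
Hypothesis mA : measurable A.

Lemma L2_cst0 : L2 mu A (fun=> 0).
Proof.
split => //; under eq_integral do rewrite expr0n/=.
by rewrite integral0.
Qed.

Lemma L2_sum (I : Type) (s : seq I) (F : I -> T -> R) :
  (forall i, L2 mu A (F i)) -> L2 mu A (fun x => \sum_(i <- s) F i x).
Proof.
move=> LF; elim: s => [|i s IHs].
  by rewrite (_ : (fun _ => _) = (fun=> 0)); [exact: L2_cst0|
    apply/funext => x; rewrite big_nil].
rewrite (_ : (fun _ => _) = F i + (fun x => \sum_(j <- s) F j x)).
  exact: (siD (ip_semi_inner mu mA)).
by apply/funext => x; rewrite big_cons.
Qed.

Lemma L2_mdot m n (F : T -> 'M[R]_(m, n)) (w : 'M[R]_(m, n)) :
  L2mx mu A F -> L2 mu A (fun x => mdot (F x) w).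
Proof.
move=> LF; apply: L2_sum => i; apply: L2_sum => j.
rewrite (_ : (fun _ => _) = w i j *: (fun x => F x i j)).
  exact: (siZ (ip_semi_inner mu mA)).
by apply/funext => x; rewrite -[RHS]/(w i j * F x i j) mulrC.
Qed.

Lemma ipmx_integrable m n (F : T -> 'M[R]_(m, n)) : L2mx mu A F ->
  mu.-integrable A (EFin \o (fun x => mdot (F x) (F x))).
Proof.
move=> LF; have ii i j := L2_integrable mA (LF i j) (LF i j).
rewrite (_ : EFin \o _ = (fun x =>
  \sum_i \sum_j (EFin \o (fun x => F x i j * F x i j)%R) x)%E).
  by apply: integrable_sum => // i _; apply: integrable_sum => // j _; exact: ii.
by apply/funext => x /=; rewrite /mdot -sumEFin; apply: eq_bigr => i _;
  rewrite sumEFin.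
Qed.

Lemma ip_mdot_unit_le m n (F : T -> 'M[R]_(m, n)) (w : 'M[R]_(m, n)) :
  mdot w w = 1 -> L2mx mu A F ->
  ip mu A (fun x => mdot (F x) w) (fun x => mdot (F x) w) <= ipmx mu A F F.
Proof.
move=> w1 LF; apply: le_Rintegral => //.
- exact: (L2_integrable mA (L2_mdot w LF) (L2_mdot w LF)).
- exact: ipmx_integrable.
- by move=> x _ /=; rewrite -expr2 mdot_unit_le.
Qed.

End L2_mdot.

(** * The geometry and the foot of the characteristics *)

Section geometry.
Variables (R : realType) (d : nat) (g : geometry R d).
Hypothesis g_ok : is_geometry g.
Local Notation X := 'rV[R]_d.+1.
Local Notation leb := (lebesgue_rV R d.+1).

Lemma measurable_open_mx m n (U : set 'M[R]_(m, n)) : open U -> measurable U.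
Proof. by move=> oU; exact: sub_sigma_algebra. Qed.

Lemma measurable_Omc : measurable (Omc g).
Proof. by apply: measurable_open_mx; exact: Omc_open. Qed.

Lemma measurable_Omd : measurable (Omd g).
Proof. by apply: measurable_open_mx; exact: Omd_open. Qed.

Lemma measurable_interface : measurable (interface g).
Proof.
rewrite -[interface g]setCK; apply: measurableC; apply: measurable_open_mx.
by apply: closed_openC; apply: closedI; exact: closed_closure.
Qed.

(** The foot map is the composition of the extension by zero of [u] from
    Omega_c and the interface with a map that is measurable on Omega_c. This is
    why [u] has to be measurable on the interface too, although the interface
    is a null set. *)
Lemma measurable_foot dt (u : X -> X) i :
  (forall i, measurable_fun (Omc g) (fun x => u x 0 i)) ->
  (forall i, measurable_fun (interface g) (fun x => u x 0 i)) ->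
  measurable_fun (Omc g) (fun x => foot g dt u x 0 i).
Proof.
move=> mc mI.
have mOc := measurable_Omc; have mIf := measurable_interface.
pose uc j := (fun x => u x 0 j) \_ (Omc g).
have muc j : measurable_fun setT (uc j) by apply/(measurable_restrictT _ mOc); exact: mc.
pose y (x : X) : X := \row_j (x 0 j - dt * uc j x).
have my : measurable_fun setT y.
  apply: (@measurable_row R _ X d.+1 (fun j x => x 0 j - dt * uc j x)) => j.
  by apply: measurable_funB; [exact: measurable_coord|exact: measurable_funM].
have mU : measurable_fun setT ((fun x => u x 0 i) \_ (Omc g `|` interface g)).
  have mcI : measurable (Omc g `|` interface g) by exact: measurableU.
  apply/(measurable_restrictT _ mcI).
  by apply/(measurable_funU _ mOc mIf); split.
have := measurable_funS measurableT (@subsetT _ (Omc g)) (measurableT_comp mU my).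
apply: eq_measurable_fun => x xc.
rewrite /= /foot /patch (_ : y x = x - dt *: u x).
  by case: ifP => // _; rewrite mxE.
by apply/rowP => j; rewrite !mxE /uc /patch xc.
Qed.

Lemma L2_foot Chat dt (u : X -> X) :
  L2mx leb (Omc g) u -> L2mx (surface g) (interface g) u ->
  characteristic_bound g Chat dt u ->
  L2mx leb (Omc g) (foot g dt u) /\
  ipmx leb (Omc g) (foot g dt u) (foot g dt u) <=
    (1 + Chat * dt) * ipmx leb (Omc g) u u.
Proof.
move=> Lu LI.
have mOc := measurable_Omc.
have mf i : measurable_fun (Omc g) (fun x => foot g dt u x 0 i).
  by apply: measurable_foot => j; [exact: (Lu 0 j).1|exact: (LI 0 j).1].
rewrite /characteristic_bound /ipmx /Rintegral.
have Ufin := integrable_fin_num mOc (ipmx_integrable mOc Lu).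
rewrite (_ : \int[_]_(x in _) _ = \int[leb]_(x in Omc g) (mdot (u x) (u x))%:E)%E
  // in Ufin.
move: Ufin; set U := (\int[_]_(x in _) (mdot (u x) (u x))%:E)%E => Ufin.
set F := (\int[_]_(x in _) _)%E => FU.
have F0 : (0 <= F)%E.
  by apply: integral_ge0 => x _; rewrite lee_fin mdot_ge0.
have Ffin : F \is a fin_num.
  move: FU; rewrite -(fineK Ufin) fin_numElt.
  case: F F0 => [r||]//= _; first by rewrite ltNyr ltry.
have {}FU : fine F <= (1 + Chat * dt) * fine U.
  by move: FU; rewrite -(fineK Ufin) -(fineK Ffin) /= -EFinM -EFinB lee_fin; lra.
split => // i j; rewrite ord1; split; first exact: mf.
apply: (@le_lt_trans _ _ F); last by rewrite -ge0_fin_numE.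
apply: ge0_le_integral => //.
- by move=> x _; rewrite lee_fin sqr_ge0.
- apply/measurable_EFinP; exact: measurable_funX.
- apply/measurable_EFinP; rewrite /mdot.
  apply: measurable_sum => k; apply: measurable_sum => l.
  by rewrite ord1; apply: measurable_funM.
- move=> x _; rewrite lee_fin /mdot big_ord1 (bigD1 j)//= -expr2 lerDl.
  by apply: sumr_ge0 => k _; rewrite -expr2 sqr_ge0.
Qed.

End geometry.

(** * Poincare, trace and dual norm bounds *)

Section bounds.
Variables (R : realType) (d : nat) (g : geometry R d).
Hypothesis g_ok : is_geometry g.
Local Notation X := 'rV[R]_d.+1.
Local Notation leb := (lebesgue_rV R d.+1).
Local Notation I := (interface g).

Lemma normc_sqr m n (F : X -> 'M[R]_(m, n)) :
  normc g F ^+ 2 = ipmx leb (Omc g) F F.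
Proof. exact: L2normmx_sqr (measurable_Omc g_ok) _ _ _. Qed.

Lemma normd_sqr f : normd g f ^+ 2 = ip leb (Omd g) f f.
Proof. exact: L2norm_sqr (measurable_Omd g_ok) _. Qed.

Lemma normdv_sqr (F : X -> X) : normdv g F ^+ 2 = ipmx leb (Omd g) F F.
Proof. exact: L2normmx_sqr (measurable_Omd g_ok) _ _ _. Qed.

Lemma normI_sqr f : normI g f ^+ 2 = ip (surface g) I f f.
Proof. exact: L2norm_sqr (measurable_interface g) _. Qed.

Lemma normIv_sqr (F : X -> X) : normIv g F ^+ 2 = ipmx (surface g) I F F.
Proof. exact: L2normmx_sqr (measurable_interface g) _ _ _. Qed.

Lemma Hm1norm_bound (f : H1fun R d -> R) v : Hm1 g f -> Yc g v ->
  `|f v| <= Hm1norm g f * H1norm g v.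
Proof.
move=> [_ [K fK]] vY; have [v0|v0] := eqVneq (H1norm g v) 0.
  by rewrite v0 mulr0; have := fK _ vY; rewrite v0 mulr0.
have pos u : 0 <= H1norm g u := sqrtr_ge0 _.
have vp : 0 < H1norm g v by rewrite lt0r v0 pos.
rewrite -ler_pdivrMr//; apply: ub_le_sup; last by exists v.
exists K => _ [u [uY u0] <-].
by rewrite ler_pdivrMr ?fK// lt0r u0 pos.
Qed.

(** The dual norm refers to the full H^1 norm, whence the factor
    [CPF ^+ 2 + 1] in place of [CPF ^+ 2]. *)
Lemma Hm1_young CPF e (f : H1fun R d -> R) v :
  poincare_friedrichs g CPF -> 0 < e -> Hm1 g f -> Yc g v ->
  2 * f v <= e * normc g v.2 ^+ 2 + (CPF ^+ 2 + 1) / e * Hm1norm g f ^+ 2.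
Proof.
move=> pf e0 hf vY.
have K0 : 0 < CPF ^+ 2 + 1 by rewrite ltr_pwDr// sqr_ge0.
have hH : H1norm g v ^+ 2 <= (CPF ^+ 2 + 1) * normc g v.2 ^+ 2.
  rewrite sqr_sqrtr ?addr_ge0 ?sqr_ge0// mulrDl mul1r lerD2r -exprMn.
  rewrite ler_sqr ?nnegrE ?sqrtr_ge0//; first exact: pf.
  by apply: le_trans (pf _ vY); exact: sqrtr_ge0.
have hf1 : f v <= Hm1norm g f * H1norm g v.
  exact: le_trans (ler_norm _) (Hm1norm_bound hf vY).
move: hH hf1; set K := CPF ^+ 2 + 1 in K0 *.
set F := Hm1norm g f; set H := H1norm g v; set G := normc g v.2 ^+ 2 => hH hf1.
have h2 : e / K * H ^+ 2 <= e * G.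
  by rewrite -mulrA ler_pM2l// ler_pdivrMl.
have : 0 <= e / K * (H - K / e * F) ^+ 2.
  by rewrite mulr_ge0 ?sqr_ge0// divr_ge0 ?ltW.
have -> : e / K * (H - K / e * F) ^+ 2 =
    e / K * H ^+ 2 - 2 * (F * H) + K / e * F ^+ 2.
  by field; rewrite !gt_eqF.
lra.
Qed.

Lemma phi_interface_sqr Cinv h (Q : set (X -> R)) phi : 0 < h ->
  inverse_trace_inequality g Cinv h Q -> Q phi ->
  ip (surface g) I phi phi <= Cinv ^+ 2 / h * normd g phi ^+ 2.
Proof.
move=> h0 inv Qphi; rewrite -normI_sqr.
rewrite (_ : Cinv ^+ 2 / h * _ =
    (Cinv * (Num.sqrt h)^-1 * normd g phi) ^+ 2).
  rewrite ler_sqr ?nnegrE ?sqrtr_ge0//; first exact: inv.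
  by apply: le_trans (inv _ Qphi); exact: sqrtr_ge0.
by rewrite !exprMn exprVn (@sqr_sqrtr _ h) ?ltW.
Qed.

Lemma trace_sqr CPF CT v :
  poincare_friedrichs g CPF -> trace_inequality g CT -> Yc g v ->
  ipmx (surface g) I v.1 v.1 <= CT ^+ 2 * CPF * normc g v.2 ^+ 2.
Proof.
move=> pf tr vY; rewrite -normIv_sqr.
have n1 : 0 <= normc g v.1 := sqrtr_ge0 _.
have n2 : 0 <= normc g v.2 := sqrtr_ge0 _.
apply: (@le_trans _ _ ((CT * Num.sqrt (normc g v.1) *
    Num.sqrt (normc g v.2)) ^+ 2)).
  rewrite ler_sqr ?nnegrE ?sqrtr_ge0//; first exact: tr.
  by apply: le_trans (tr _ vY); exact: sqrtr_ge0.
rewrite !exprMn (sqr_sqrtr n1) (sqr_sqrtr n2) -[leLHS]mulrA -[leRHS]mulrA.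
rewrite ler_wpM2l ?sqr_ge0// expr2 mulrA ler_wpM2r//; exact: pf.
Qed.

End bounds.

(** * Energy identities of the three steps *)

Section steps.
Variables (R : realType) (d : nat) (g : geometry R d) (P : params R).
Hypotheses (g_ok : is_geometry g) (P_gt0 : positive_params P).
Local Notation X := 'rV[R]_d.+1.
Local Notation leb := (lebesgue_rV R d.+1).
Local Notation I := (interface g).
Let mOc := measurable_Omc g_ok.
Let mOd := measurable_Omd g_ok.
Let mI := measurable_interface g.

(** The factors [Num.sqrt D] cancel, as the trace of the permeability tensor is
    [D * kf P]. *)
Lemma a_c_diag (u : H1fun R d) : L2mx (surface g) I u.1 ->
  a_c g P u u = nu P * normc g u.2 ^+ 2 +
    alpha P * nu P / Num.sqrt (kf P) *
      normIv g (fun x => Ptau g (u.1 x)) ^+ 2.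
Proof.
move=> Lu; have [_ [_ [kf0 _ _]]] := P_gt0.
rewrite /a_c normc_sqr// normIv_sqr; congr (_ + _).
have LT i : L2 (surface g) I (fun x => mdot (u.1 x) (row i (tau g))).
  exact: L2_mdot.
rewrite (_ : ipmx _ _ _ _ = \sum_(i < d) ip (surface g) I
    (fun x => mdot (u.1 x) (row i (tau g)))
    (fun x => mdot (u.1 x) (row i (tau g)))); last first.
  rewrite -Rintegral_sum//; last by move=> i; exact: L2_integrable.
  apply: eq_Rintegral => x _.
  by rewrite mdot_Ptau ?(tau_orthonormal g_ok)//; apply: eq_bigr => i _; rewrite expr2.
rewrite mulr_sumr; apply: eq_bigr => i _.
rewrite -RintegralZl//; last exact: L2_integrable.
apply: eq_Rintegral => x _; rewrite mulrA; congr (_ * _ * _).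
rewrite mxtrace_scalar -(mulr_natr (kf P)) (@sqrtrM _ (kf P)) ?ltW//.
have D0 : Num.sqrt (d.+1%:R) != 0 :> R by rewrite gt_eqF// sqrtr_gt0.
have K0 : Num.sqrt (kf P) != 0 by rewrite gt_eqF// sqrtr_gt0.
by field; rewrite K0 D0.
Qed.

(** The interface term 2 (a - b, a) is kept as three squares, and the pressure
    and body force pairings are left to be estimated. *)
Lemma step1_energy (S : fe_spaces R d) h dt Chat f u u' p' uf phif :
  0 < dt -> Yc g u -> Yc g u' -> Ych S u' -> Qch S p' ->
  L2mx (surface g) I uf.1 -> L2 (surface g) I phif ->
  characteristic_bound g Chat dt u.1 ->
  step1 g P S h dt f u u' p' uf phif ->
  normc g u'.1 ^+ 2 + 2 * nu P * dt * normc g u'.2 ^+ 2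
  + 2 * alpha P * nu P * dt / Num.sqrt (kf P) *
      normIv g (fun x => Ptau g (u'.1 x)) ^+ 2
  + gamma P * dt / (rho P * h) *
      (normI g (fun x => mdot (u'.1 x - uf.1 x) (nd g)) ^+ 2
       + normI g (fun x => mdot (u'.1 x) (nd g)) ^+ 2
       - normI g (fun x => mdot (uf.1 x) (nd g)) ^+ 2)
  <= (1 + Chat * dt) * normc g u.1 ^+ 2 + dt * (2 * f u')
     + dt / rho P *
       (2 * ip (surface g) I phif (fun x => mdot (u'.1 x) (nd g))).
Proof.
move=> dt0 [uL _ _ uI _] [u'L _ _ u'I _] u'S p'S ufI phiI cb /(_ _ _ u'S p'S).
have [foL fo_le] := L2_foot g_ok uL uI cb.
have SI := ipmx_semi_inner leb mOc 1 d.+1.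
pose a x := mdot (u'.1 x) (nd g); pose b x := mdot (uf.1 x) (nd g).
have aL : L2 (surface g) I a by exact: L2_mdot.
have bL : L2 (surface g) I b by exact: L2_mdot.
rewrite a_c_diag// (_ : ipmx _ _ (fun x => dt^-1 *: (u'.1 x - u.1 x)) _ =
  dt^-1 * (ipmx leb (Omc g) u'.1 u'.1 - ipmx leb (Omc g) u.1 u'.1)); last first.
  rewrite -(siBl SI)// -(siZl SI)//; exact: (siB SI).
rewrite (_ : ipmx _ _ (fun x => dt^-1 *: (u.1 x - foot g dt u.1 x)) _ =
  dt^-1 * (ipmx leb (Omc g) u.1 u'.1 - ipmx leb (Omc g) (foot g dt u.1) u'.1));
    last first.
  rewrite -(siBl SI)// -(siZl SI)//; exact: (siB SI).
rewrite (_ : \int[_]_(x in _) (mdot (u'.1 x - uf.1 x) _ * _) =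
  ip (surface g) I (a - b) a); last first.
  by apply: eq_Rintegral => x _; rewrite mdotBl.
rewrite (_ : \int[_]_(x in _) (phif x * _) = ip (surface g) I phif a)//.
rewrite (_ : (fun x => mdot (u'.1 x - uf.1 x) (nd g)) = a - b); last first.
  by apply/funext => x; rewrite mdotBl.
rewrite !(normI_sqr, normc_sqr g_ok u'.1, normc_sqr g_ok u.1).
have := si_polar (ip_semi_inner _ mI) aL bL.
have := si_young SI (@ltr01 R) foL u'L; rewrite invr1 !mul1r.
rewrite (_ : (fun x => mdot (u'.1 x) (nd g)) = a)//.
rewrite (_ : (fun x => mdot (uf.1 x) (nd g)) = b)//.
move: fo_le.
set FF := ipmx _ _ (foot g dt u.1) (foot g dt u.1).
set FU := ipmx _ _ (foot g dt u.1) _.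
set UU := ipmx _ _ u.1 u.1; set UU' := ipmx _ _ u.1 u'.1.
set U'U' := ipmx _ _ u'.1 u'.1.
set G := normc _ _ ^+ 2; set Tn := normIv _ _ ^+ 2.
set AB := ip _ _ (a - b) (a - b); set ABa := ip _ _ (a - b) a.
set AA := ip _ _ a a; set BB := ip _ _ b b; set FA := ip _ _ phif a.
set q := b_c _ _ _; set fu := f u'.
move=> h1 h2 h3 E.
have {}E : dt^-1 * (U'U' - FU) + nu P * G +
    alpha P * nu P / Num.sqrt (kf P) * Tn - (rho P)^-1 * FA +
    gamma P / (rho P * h) * ABa - fu = 0 by move: E; lra.
have : 2 * dt * (dt^-1 * (U'U' - FU) + nu P * G +
    alpha P * nu P / Num.sqrt (kf P) * Tn - (rho P)^-1 * FA +
    gamma P / (rho P * h) * ABa - fu) = 0 by rewrite E mulr0.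
have -> : 2 * dt * (dt^-1 * (U'U' - FU) + nu P * G +
    alpha P * nu P / Num.sqrt (kf P) * Tn - (rho P)^-1 * FA +
    gamma P / (rho P * h) * ABa - fu) =
  2 * U'U' - 2 * FU + 2 * nu P * dt * G
  + 2 * alpha P * nu P * dt / Num.sqrt (kf P) * Tn
  - dt / rho P * (2 * FA) + gamma P * dt / (rho P * h) * (2 * ABa) - dt * (2 * fu).
  rewrite -[in RHS](mulr1 U'U') -[in RHS](mulr1 FU) -(divff (lt0r_neq0 dt0)).
  by ring.
rewrite h3; lra.
Qed.

Lemma step2_energy (S : fe_spaces R d) ds phif phim phim' um' :
  0 < ds -> L2 leb (Omd g) phif -> L2 leb (Omd g) phim ->
  L2 leb (Omd g) phim' -> L2mx leb (Omd g) um'.1 ->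
  Ymh S um' -> Qmh S phim' ->
  step2 g P S ds phif phim phim' um' ->
  etam P * Cmt P / rho P *
    (normd g phim' ^+ 2 - normd g phim ^+ 2 + normd g (phim' - phim) ^+ 2)
  + 2 * mu P * ds / (rho P * km P) * normdv g um'.1 ^+ 2
  + sigma P * km P * ds / (rho P * mu P) *
    (normd g phim' ^+ 2 - normd g phif ^+ 2 + normd g (phim' - phif) ^+ 2)
  = 0.
Proof.
move=> ds0 fL mL m'L uL uS mS /(_ _ _ uS mS).
have SI := ip_semi_inner leb mOd.
rewrite (_ : ip _ _ (fun x => ds^-1 * (phim' x - phim x)) _ =
  ds^-1 * ip leb (Omd g) (phim' - phim) phim'); last first.
  by rewrite -(siZl SI)//; exact: (siB SI).
rewrite (_ : ip _ _ (fun x => phim' x - phif x) _ =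
  ip leb (Omd g) (phim' - phif) phim')//.
rewrite (_ : ipmx _ _ (fun x => (mu P / km P) *: um'.1 x) _ =
  mu P / km P * ipmx leb (Omd g) um'.1 um'.1); last first.
  by rewrite -(siZl (ipmx_semi_inner leb mOd 1 d.+1)).
rewrite (si_sym SI um'.2) !(normd_sqr g_ok, normdv_sqr g_ok) -!(si_polar SI)//.
set A1 := ip _ _ (phim' - phim) _; set A2 := ip _ _ (phim' - phif) _.
set U := ipmx _ _ _ _; set q := ip _ _ phim' _ => E.
apply: (eq_trans _ (mulr0 (2 * ds))); rewrite -[in RHS]E.
by field; rewrite !gt_eqF//; case: P_gt0 => [[_ ? _ _ ?] [_ [_ ? _]]].
Qed.

Lemma step3_energy (S : fe_spaces R d) h ds f phif phim phif' uf' Sc :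
  0 < h -> 0 < ds -> L2 leb (Omd g) phif -> L2 leb (Omd g) phim ->
  L2 leb (Omd g) phif' -> L2mx leb (Omd g) uf'.1 ->
  Yfh S uf' -> Qfh S phif' ->
  step3 g P S h ds f phif phim phif' uf' Sc ->
  etaf P * Cft P / rho P *
    (normd g phif' ^+ 2 - normd g phif ^+ 2 + normd g (phif' - phif) ^+ 2)
  + 2 * mu P * ds / (rho P * kf P) * normdv g uf'.1 ^+ 2
  + sigma P * km P * ds / (rho P * mu P) *
    (normd g phif' ^+ 2 - normd g phim ^+ 2 + normd g (phif' - phim) ^+ 2)
  + ds / rho P *
      (2 * ip (surface g) I phif (fun x => mdot (uf'.1 x) (nd g)))
  - gamma P * ds / (rho P * h) *
      (2 * ip (surface g) I (fun x => mdot (Sc x - uf'.1 x) (nd g))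
        (fun x => mdot (uf'.1 x) (nd g)))
  = ds / rho P * (2 * ip leb (Omd g) f phif').
Proof.
move=> h0 ds0 fL mL f'L uL uS fS /(_ _ _ uS fS).
have SI := ip_semi_inner leb mOd.
rewrite (_ : ip _ _ (fun x => ds^-1 * (phif' x - phif x)) _ =
  ds^-1 * ip leb (Omd g) (phif' - phif) phif'); last first.
  by rewrite -(siZl SI)//; exact: (siB SI).
rewrite (_ : ip _ _ (fun x => phif' x - phim x) _ =
  ip leb (Omd g) (phif' - phim) phif')//.
rewrite (_ : ipmx _ _ (fun x => (mu P / kf P) *: uf'.1 x) _ =
  mu P / kf P * ipmx leb (Omd g) uf'.1 uf'.1); last first.
  by rewrite -(siZl (ipmx_semi_inner leb mOd 1 d.+1)).
rewrite (si_sym SI uf'.2) !(normd_sqr g_ok, normdv_sqr g_ok) -!(si_polar SI)//.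
rewrite (_ : \int[_]_(x in _) (phif x * _) =
  ip (surface g) I phif (fun x => mdot (uf'.1 x) (nd g)))//.
rewrite (_ : \int[_]_(x in _) (mdot (Sc x - _) _ * _) =
  ip (surface g) I (fun x => mdot (Sc x - uf'.1 x) (nd g))
    (fun x => mdot (uf'.1 x) (nd g)))//.
set A1 := ip _ _ (phif' - phif) _; set A2 := ip _ _ (phif' - phim) _.
set A3 := ip _ _ phif _; set A4 := ip _ _ (fun x => mdot (Sc x - _) _) _.
set U := ipmx _ _ _ _; set q := ip _ _ phif' _ => E.
apply: (eq_trans _ (_ : 2 * ds * ((rho P)^-1 * ip leb (Omd g) f phif') = _)).
  rewrite -E.
  by field; rewrite !gt_eqF//; case: P_gt0 => [[_ ? _ _ ?] [_ [? ? _]]].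
by field; rewrite !gt_eqF//; case: P_gt0 => [[_ ? _ _ ?] [_ [? ? _]]].
Qed.

(** Averaging: the interface term of a coarse step is the mean of the terms of
    the fine steps. *)
Lemma average_interface (u : nat -> X -> X) (v : X -> X) (k r : nat) :
  (0 < r)%N ->
  (forall n, (k * r <= n < k.+1 * r)%N -> L2mx (surface g) I (u n)) ->
  L2mx (surface g) I v ->
  r%:R * ip (surface g) I
    (fun x => mdot (r%:R^-1 *: (\sum_(k * r <= n < k.+1 * r) u n x) - v x) (nd g))
    (fun x => mdot (v x) (nd g)) =
  \sum_(k * r <= n < k.+1 * r)
    ip (surface g) I (fun x => mdot (u n x - v x) (nd g))
      (fun x => mdot (v x) (nd g)).
Proof.
move=> r0 uL vL.
have r1 : r%:R != 0 :> R by rewrite pnatr_eq0 -lt0n.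
have SI := ipmx_semi_inner (surface g) mI 1 d.+1.
have SI1 := ip_semi_inner (surface g) mI.
have bL : L2 (surface g) I (fun x => mdot (v x) (nd g)) by exact: L2_mdot.
pose w n : X -> X := if (k * r <= n < k.+1 * r)%N then u n - v else 0.
have wL n : L2mx (surface g) I (w n).
  rewrite /w; case: ifP => [nk|_]; first exact (siB SI (uL n nk) vL).
  exact (si0 SI vL).
have wS x : \sum_(k * r <= n < k.+1 * r) w n x =
    r%:R *: (r%:R^-1 *: (\sum_(k * r <= n < k.+1 * r) u n x) - v x).
  rewrite scalerBr scalerA divff// scale1r.
  rewrite (eq_big_nat _ _ (F2 := fun n => u n x - v x)); last first.
    by move=> n nk; rewrite /w nk.
  by rewrite sumrB sumr_const_nat mulSn addnK scaler_nat.
have cL n : L2 (surface g) I (fun x => mdot (w n x) (nd g)) by exact: L2_mdot.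
transitivity (\sum_(k * r <= n < k.+1 * r)
    ip (surface g) I (fun x => mdot (w n x) (nd g)) (fun x => mdot (v x) (nd g)));
  last first.
  by apply: eq_big_nat => n nk; rewrite /w nk.
rewrite -Rintegral_sum//; last by move=> n; exact: L2_integrable.
rewrite -RintegralZl//.
  apply: eq_Rintegral => x _; rewrite -mulr_suml mulrA; congr (_ * _).
  rewrite -mdotZl -mdot_suml; congr (mdot _ _).
  by rewrite wS.
apply: L2_integrable => //.
have sL : L2 (surface g) I
    (fun x => \sum_(k * r <= n < k.+1 * r) mdot (w n x) (nd g)) by exact: L2_sum.
rewrite (_ : (fun _ => _) =
  r%:R^-1 *: (fun x => \sum_(k * r <= n < k.+1 * r) mdot (w n x) (nd g))).
  exact: (siZ SI1).
apply/funext => x; rewrite -[RHS]/(r%:R^-1 * (\sum_(k * r <= n < k.+1 * r) _)).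
by rewrite -mdot_suml -mdotZl wS scalerA mulVf// scale1r.
Qed.

End steps.

(** * Discrete Gronwall lemma *)

Ltac positivity := repeat first
  [ assumption | exact: sqr_ge0 | exact: ler0n | by apply: ltW
  | apply: divr_ge0 | apply: mulr_ge0 | apply: addr_ge0 ].

Lemma discrete_gronwall (R : realType) (c : R) (x D Y : nat -> R) (m j : nat) :
  0 <= c ->
  (forall n, (m <= n < m + j)%N -> 0 <= D n /\ 0 <= Y n) ->
  (forall n, (m <= n < m + j)%N -> x n.+1 + D n <= (1 + c) * x n + Y n) ->
  x (m + j)%N + \sum_(m <= n < m + j) D n <=
    (1 + c) ^+ j * (x m + \sum_(m <= n < m + j) Y n).
Proof.
move=> c0; elim: j => [|j IHj] DY st.
  by rewrite addn0 !big_geq// !addr0 expr0 mul1r.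
have /IHj{}IHj n : (m <= n < m + j)%N -> 0 <= D n /\ 0 <= Y n.
  by move=> nj; apply: DY; lia.
have {}IHj := IHj (fun n nj => st n ltac:(lia)).
have mj : (m <= m + j)%N by lia.
rewrite addnS !big_nat_recr//= exprS.
have last_in : (m <= m + j < m + j.+1)%N by lia.
have [D0 Y0] := DY _ last_in; have := st _ last_in.
have SD0 : 0 <= \sum_(m <= n < m + j) D n.
  rewrite big_nat_cond; apply: sumr_ge0 => n /andP[nj _].
  by apply: (DY n _).1; lia.
have p1 : Y (m + j)%N <= (1 + c) * (1 + c) ^+ j * Y (m + j)%N.
  by rewrite -exprS ler_peMl// exprn_ege1// lerDl.
have p2 := ler_wpM2l (addr_ge0 ler01 c0) IHj.
have p3 : 0 <= c * \sum_(m <= n < m + j) D n by rewrite mulr_ge0.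
move: IHj p1 p2 p3; rewrite mulrDr mulrDr.
set e := (1 + c) ^+ j; lra.
Qed.

(** * Fine and coarse indices *)

Lemma in_block k r i : (k * r <= i < k.+1 * r)%N ->
  exists2 j, i = (k * r + j)%N & (j < r)%N.
Proof. by move=> ik; exists (i - k * r)%N; nia. Qed.

Lemma block_in k r j n : (j < r)%N -> (k * r <= n < k * r + j)%N ->
  (k * r <= n < k.+1 * r)%N.
Proof. by rewrite mulSn; lia. Qed.

Lemma fine_index_lt k r M n : (k < M)%N -> (n < k.+1 * r)%N -> (n < r * M)%N.
Proof. by move=> kM nk; nia. Qed.

(** * One run of the scheme *)

Section run.
Variables (R : realType) (d : nat) (g : geometry R d) (P : params R).
Hypotheses (g_ok : is_geometry g) (P_gt0 : positive_params P).
Variables (T CPF CT Cinv Chat chic chif chim : R).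
Hypotheses (T_gt0 : 0 < T) (CPF_gt0 : 0 < CPF) (CT_gt0 : 0 < CT)
  (Chat_ge0 : 0 <= Chat).
Hypotheses (CPF_ok : poincare_friedrichs g CPF) (CT_ok : trace_inequality g CT).
Variables (N M r : nat).
Hypotheses (M_gt0 : (0 < M)%N) (r_gt0 : (0 < r)%N) (NrM : N = (r * M)%N).
Variables (h : R) (Th : seq (simplex R d)) (S : fe_spaces R d).
Hypotheses (h_gt0 : 0 < h) (S_ok : is_fe_spaces g Th chic chif chim S)
  (Cinv_ok : inverse_trace_inequality g Cinv h (Qfh S)).
Variables (Ph : projections R d) (fc : R -> H1fun R d -> R)
  (fd : R -> 'rV[R]_d.+1 -> R).
Hypotheses (Ph_ok : is_projections g S Ph) (fc_ok : L2Hm1 g T fc)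
  (fd_ok : L2L2 g T fd).
Variables (uc0 : H1fun R d) (phim0 phif0 : 'rV[R]_d.+1 -> R).
Hypotheses (uc0_ok : Yc g uc0) (phim0_ok : L20 (Omd g) phim0)
  (phif0_ok : L20 (Omd g) phif0).
Variable w : iterates R d.
Hypothesis w_initial : is_initial S Ph uc0 phim0 phif0 w.
Local Notation dt := (T / N%:R).
Local Notation ds := (T / M%:R).
Hypothesis w_sol : is_solution g P S h dt ds M r fc fd w.
Hypothesis w_char :
  forall n, (n < N)%N -> characteristic_bound g Chat dt (uc w n).1.
Local Notation X := 'rV[R]_d.+1.
Local Notation leb := (lebesgue_rV R d.+1).
Local Notation I := (interface g).

Lemma grid_in a b : (0 < b)%N -> (a <= b)%N ->
  `[0, T]%classic (a%:R * (T / b%:R)).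
Proof.
move=> b0 ab; have b1 : 0 < b%:R :> R by rewrite ltr0n.
rewrite /= in_itv/=; apply/andP; split.
  by rewrite mulr_ge0// divr_ge0// ltW.
by rewrite mulrA ler_pdivrMr// mulrC ler_wpM2l ?ler_nat// ltW.
Qed.

Lemma N_gt0 : (0 < N)%N. Proof. by rewrite NrM muln_gt0 r_gt0. Qed.

Lemma r_le_N : (r <= N)%N. Proof. by rewrite NrM leq_pmulr. Qed.

Lemma dt_gt0 : 0 < dt. Proof. by rewrite divr_gt0// ltr0n N_gt0. Qed.

Lemma ds_gt0 : 0 < ds. Proof. by rewrite divr_gt0// ltr0n. Qed.

Lemma ds_le_T : ds <= T.
Proof. by rewrite ler_pdivrMr ?ltr0n// ler_peMr ?ler1n// ltW. Qed.

Lemma dt_ds : r%:R * dt = ds.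
Proof.
rewrite NrM natrM; field.
by rewrite !pnatr_eq0 -!lt0n r_gt0 M_gt0.
Qed.

Lemma block_lt k n : (k < M)%N -> (n < k.+1 * r)%N -> (n < N)%N.
Proof. by rewrite NrM => kM nk; nia. Qed.

Lemma uc_fe n : (n <= N)%N -> Ych S (uc w n).
Proof.
case: n => [_|n nN].
  by case: w_initial => -> _ _ _; case: (PYc_proj Ph_ok) => /(_ _ uc0_ok).
have kM : (n %/ r < M)%N by rewrite ltn_divLR// mulnC -NrM.
have nk : (n %/ r * r <= n < (n %/ r).+1 * r)%N.
  by rewrite leq_trunc_div/= -ltn_divLR.
by case: (solution_c w_sol kM nk).
Qed.

Lemma uc_Yc n : (n <= N)%N -> Yc g (uc w n).
Proof. by move=> /uc_fe uS; exact: (Ych_conforming S_ok uS). Qed.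

Lemma uc_L2I n : (n <= N)%N -> L2mx (surface g) I (uc w n).1.
Proof. by case/uc_Yc. Qed.

Lemma phif_fe k : (k <= M)%N -> Qfh S (phif w k).
Proof.
case: k => [_|k kM]; last by case: (solution_f w_sol kM).
by case: w_initial => _ _ -> _; case: (PQf_proj Ph_ok) => /(_ _ phif0_ok).
Qed.

Lemma phif_L2 k : (k <= M)%N -> L2 leb (Omd g) (phif w k).
Proof. by move=> /phif_fe; case: (Qfh_fe S_ok) => QL _ _ /QL[]. Qed.

Lemma phif_L2I k : (k <= M)%N -> L2 (surface g) I (phif w k).
Proof. by move=> /phif_fe Q; exact (Qfh_trace_L2 S_ok Q). Qed.

Lemma phim_L2 k : (k <= M)%N -> L2 leb (Omd g) (phim w k).
Proof.
move=> kM; suff : Qmh S (phim w k) by case: (Qmh_fe S_ok) => QL _ _ /QL[].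
case: k kM => [_|k kM]; last by case: (solution_m w_sol kM).
by case: w_initial => _ -> _ _; case: (PQm_proj Ph_ok) => /(_ _ phim0_ok).
Qed.

Lemma uf_fe k : (k <= M)%N -> Yfh S (uf w k).
Proof.
by case: k => [_|k kM]; [case: w_initial|case: (solution_f w_sol kM)].
Qed.

Lemma uf_L2I k : (k <= M)%N -> L2mx (surface g) I (uf w k).1.
Proof. by move=> /uf_fe Y; exact (Yfh_trace_L2 S_ok Y). Qed.

Lemma uf_L2 k : (k <= M)%N -> L2mx leb (Omd g) (uf w k).1.
Proof. by move=> /uf_fe; case: (Yfh_fe S_ok) => YY _ _ /YY[[]]. Qed.

Lemma um_L2 k : (k < M)%N -> L2mx leb (Omd g) (um w k.+1).1.
Proof.
by case/(solution_m w_sol) => Y _ _; case: (Ymh_fe S_ok) => /(_ _ Y)[[]].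
Qed.

Lemma fc_Hm1 n : (n < N)%N -> Hm1 g (fc (n.+1%:R * dt)).
Proof.
by move=> nN; case: fc_ok => + _ _; apply; exact: (grid_in N_gt0).
Qed.

Lemma fd_L2 k : (k < M)%N -> L2 leb (Omd g) (fd (k.+1%:R * ds)).
Proof.
by move=> kM; case: fd_ok => + _ _; apply; exact: grid_in.
Qed.

(** Squared norms of the iterates, the fine index being [n] and the coarse one
    [k]: [x], [G] and [Tn] for the conduit velocity, its gradient and its
    tangential trace, [F] for the body force, [AA] and [BB] for the normal
    traces of the two velocities and [AB] for their jump, [Pf] and [Pm] for the
    pressures. Apart from [x], the fine quantities belong to the new time
    level. *)
Let x n := normc g (uc w n).1 ^+ 2.
Let G n := normc g (uc w n.+1).2 ^+ 2.
Let Tn n := normIv g (fun x => Ptau g ((uc w n.+1).1 x)) ^+ 2.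
Let F n := Hm1norm g (fc (n.+1%:R * dt)) ^+ 2.
Let AB k n :=
  normI g (fun x => mdot ((uc w n.+1).1 x - (uf w k).1 x) (nd g)) ^+ 2.
Let AA n := normI g (fun x => mdot ((uc w n.+1).1 x) (nd g)) ^+ 2.
Let BB k := normI g (fun x => mdot ((uf w k).1 x) (nd g)) ^+ 2.
Let Pf k := normd g (phif w k) ^+ 2.
Let Pm k := normd g (phim w k) ^+ 2.
Let cT := 2 * alpha P * nu P * dt / Num.sqrt (kf P).
Let cI := gamma P * dt / (rho P * h).
Let K := CPF ^+ 2 + 1.
(** Twice the pairing of the old pressure with the normal trace of the conduit,
    resp. microfracture, velocity. *)
Let phia k n :=
  2 * ip (surface g) I (phif w k) (fun x => mdot ((uc w n.+1).1 x) (nd g)).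
Let phib k l :=
  2 * ip (surface g) I (phif w k) (fun x => mdot ((uf w l).1 x) (nd g)).

Lemma fine_step e k n : 0 < e -> (k < M)%N -> (k * r <= n < k.+1 * r)%N ->
  x n.+1 + 2 * nu P * dt * G n + cT * Tn n + cI * (AB k n + AA n - BB k)
  <= (1 + Chat * dt) * x n + dt * (e * G n + K / e * F n) + dt / rho P * phia k n.
Proof.
move=> e0 kM nk; have nN : (n < N)%N by case/andP: nk => _; exact: block_lt.
have [uS pS st] := solution_c w_sol kM nk.
have hf := Hm1_young CPF_ok e0 (fc_Hm1 nN) (uc_Yc nN).
have := step1_energy g_ok P_gt0 dt_gt0 (uc_Yc (ltnW nN)) (uc_Yc nN) uS pS
  (uf_L2I (ltnW kM)) (phif_L2I (ltnW kM)) (w_char nN) st.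
move/le_trans; apply; rewrite lerD2r lerD2l.
by rewrite ler_wpM2l// ltW// dt_gt0.
Qed.

Lemma phia_young e k n : 0 < e -> (k <= M)%N -> (n < N)%N ->
  phia k n <= e * (Cinv ^+ 2 / h * Pf k) + e^-1 * AA n.
Proof.
move=> e0 kM nN; have aL := L2_mdot (measurable_interface g) (nd g) (uc_L2I nN).
have := si_young (ip_semi_inner (surface g) (measurable_interface g)) e0
  (phif_L2I kM) aL.
move/le_trans; apply; rewrite /AA normI_sqr lerD2r ler_pM2l//.
exact: phi_interface_sqr h_gt0 Cinv_ok (phif_fe kM).
Qed.

Lemma AA_le_G n : (n < N)%N -> AA n <= CT ^+ 2 * CPF * G n.
Proof.
move=> nN; apply: (le_trans _ (trace_sqr CPF_ok CT_ok (uc_Yc nN))).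
rewrite /AA normI_sqr; apply: ip_mdot_unit_le (uc_L2I nN).
- exact: measurable_interface.
- exact: nd_unit g_ok.
Qed.

(** The growth of the fine steps is bounded uniformly in the step size. *)
Lemma growth_le j : (j <= N)%N -> (1 + Chat * dt) ^+ j <= expR (Chat * T).
Proof.
move=> jN; have dt0 := ltW dt_gt0.
apply: (@le_trans _ _ (expR (Chat * dt) ^+ j)).
  apply: lerXn2r; rewrite ?nnegrE ?expR_ge0 ?expR_ge1Dx//.
  by rewrite addr_ge0// mulr_ge0.
rewrite -expRM_natl ler_expR mulrCA ler_wpM2l//.
rewrite mulrA ler_pdivrMr ?ltr0n ?N_gt0// mulrC ler_wpM2l ?ler_nat// ltW//.
Qed.

Let pos_params : [/\ 0 < nu P, 0 < mu P, 0 < rho P, 0 < gamma P & 0 < sigma P].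
Proof. by case: P_gt0 => [[? ? ? ? ?] [_ [_ _ ?]]]. Qed.

Let pos_coefs : [/\ 0 < alpha P, 0 < etaf P * Cft P, 0 < etam P * Cmt P,
  0 < kf P & 0 < km P].
Proof.
by case: P_gt0 => [[? ? ? ? ?] [[? ? ? ?] [? ? ?]]]; split => //; exact: mulr_gt0.
Qed.

Let K_gt0 : 0 < K. Proof. by rewrite ltr_pwDr// sqr_ge0. Qed.

Let cT_ge0 : 0 <= cT.
Proof.
have [? _ _ _ _] := pos_params; have [? _ _ _ _] := pos_coefs.
by rewrite divr_ge0 ?sqrtr_ge0// !mulr_ge0// ltW// dt_gt0.
Qed.

Let cI_gt0 : 0 < cI.
Proof.
have [_ _ ? ? _] := pos_params.
by rewrite divr_gt0// mulr_gt0// dt_gt0.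
Qed.

Let sqG n : 0 <= G n. Proof. exact: sqr_ge0. Qed.
Let sqTn n : 0 <= Tn n. Proof. exact: sqr_ge0. Qed.
Let sqF n : 0 <= F n. Proof. exact: sqr_ge0. Qed.
Let sqAB k n : 0 <= AB k n. Proof. exact: sqr_ge0. Qed.
Let sqAA n : 0 <= AA n. Proof. exact: sqr_ge0. Qed.
Let sqBB k : 0 <= BB k. Proof. exact: sqr_ge0. Qed.
Let sqPf k : 0 <= Pf k. Proof. exact: sqr_ge0. Qed.
Let sqPm k : 0 <= Pm k. Proof. exact: sqr_ge0. Qed.

(** * The first coarse interval *)

Lemma first_interval J : (J < r)%N ->
  x J.+1
  + nu P * dt / 2 * (\sum_(0 <= n < J.+1) G n)
  + cT * (\sum_(0 <= n < J.+1) Tn n)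
  + cI * (\sum_(0 <= n < J.+1) AB 0 n)
  + cI * (\sum_(0 <= n < J.+1) AA n)
  <= expR (Chat * T) * (3 + (CPF ^+ 2)^-1) *
     (2 * CPF ^+ 2 * dt / nu P * (\sum_(0 <= n < J.+1) F n)
      + CT ^+ 2 * Cinv ^+ 2 * CPF * dt / (rho P ^+ 2 * nu P * h) *
        (\sum_(0 <= n < J.+1) Pf 0)
      + cI * (\sum_(0 <= n < J.+1) BB 0) + x 0).
Proof.
move=> Jr; have [nu0 _ rho0 _ _] := pos_params; have dt0 := dt_gt0.
have ct0 : 0 < CT ^+ 2 * CPF by rewrite mulr_gt0// exprn_gt0.
pose cP := CT ^+ 2 * Cinv ^+ 2 * CPF * dt / (rho P ^+ 2 * nu P * h).
have cP0 : 0 <= cP by rewrite /cP; positivity.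
pose cF := 2 * K * dt / nu P.
have cF0 : 0 <= cF by rewrite /cF; positivity.
pose D n := nu P * dt / 2 * G n + cT * Tn n + cI * AB 0 n + cI * AA n.
pose Y n := cF * F n + 2 * cP * Pf 0 + cI * BB 0.
have nd0 : 0 <= nu P * dt by rewrite mulr_ge0// ltW.
have D0 n : 0 <= D n.
  have cI0 := ltW cI_gt0.
  by rewrite /D; positivity.
have Y0 n : 0 <= Y n.
  have cI0 := ltW cI_gt0.
  by rewrite /Y; positivity.
have st n : (0 <= n < 0 + J.+1)%N -> x n.+1 + D n <= (1 + Chat * dt) * x n + Y n.
  move=> nJ.
  have nk : (0 * r <= n < 1 * r)%N.
    by rewrite mul0n mul1n; exact: (leq_trans (proj2 (andP nJ)) Jr).
  have nN := block_lt M_gt0 (proj2 (andP nk)).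
  have h1 := fine_step (divr_gt0 nu0 (ltr0Sn R 1)) M_gt0 nk.
  (* The weight absorbs the trace of the velocity into part of the viscous
     term. *)
  pose e := 2 * (CT ^+ 2 * CPF) / (rho P * nu P).
  have e0 : 0 < e by rewrite divr_gt0// mulr_gt0.
  have h2 := phia_young e0 (leq0n M) nN.
  have h3 : e^-1 * AA n <= rho P * nu P / 2 * G n.
    apply: le_trans (_ : e^-1 * (CT ^+ 2 * CPF * G n) <= _).
      by rewrite ler_wpM2l ?AA_le_G// ltW// invr_gt0.
    by rewrite le_eqVlt; apply/orP; left; apply/eqP; rewrite /e; field;
      rewrite !gt_eqF ?ltr0n ?N_gt0.
  have h4 : dt / rho P * phia 0 n <= nu P * dt / 2 * G n + 2 * cP * Pf 0.
    apply: le_trans (_ : dt / rho P * (e * (Cinv ^+ 2 / h * Pf 0) +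
        rho P * nu P / 2 * G n) <= _).
      apply: ler_wpM2l; first by positivity.
      by apply: (le_trans h2); rewrite lerD2l.
    rewrite le_eqVlt; apply/orP; left; apply/eqP; rewrite /e /cP; field.
    by rewrite !gt_eqF ?ltr0n ?N_gt0.
  have h5 : dt * (nu P / 2 * G n + K / (nu P / 2) * F n) =
      nu P * dt / 2 * G n + cF * F n.
    by rewrite /cF; field; rewrite !gt_eqF ?ltr0n ?N_gt0.
  have := mulr_ge0 nd0 (sqG n).
  rewrite /D /Y; move: h1; rewrite h5; lra.
rewrite (_ : x J.+1 + _ + _ + _ + _ = x J.+1 + \sum_(0 <= n < J.+1) D n);
  last by rewrite /D !big_split/= -!mulr_sumr !addrA.
apply: (le_trans (discrete_gronwall (mulr_ge0 Chat_ge0 (ltW dt0))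
  (fun n _ => conj (D0 n) (Y0 n)) st)).
have SY0 : 0 <= x 0 + \sum_(0 <= n < J.+1) Y n.
  by rewrite addr_ge0 ?sqr_ge0// sumr_ge0.
apply: (le_trans (ler_wpM2r SY0 (growth_le (leq_trans Jr r_le_N)))).
rewrite -[leRHS]mulrA ler_wpM2l ?expR_ge0//.
have -> : \sum_(0 <= n < J.+1) Y n = cF * (\sum_(0 <= n < J.+1) F n) +
    2 * cP * (\sum_(0 <= n < J.+1) Pf 0) + cI * (\sum_(0 <= n < J.+1) BB 0).
  by rewrite !mulr_sumr -!big_split.
rewrite -/cP.
have SF : 0 <= \sum_(0 <= n < J.+1) F n by exact: sumr_ge0.
have SP : 0 <= \sum_(0 <= n < J.+1) Pf 0 by exact: sumr_ge0.
have SB : 0 <= \sum_(0 <= n < J.+1) BB 0 by exact: sumr_ge0.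
have x0 : 0 <= x 0 by exact: sqr_ge0.
have i0 : 0 <= (CPF ^+ 2)^-1 by rewrite invr_ge0 sqr_ge0.
have cFE : cF = (1 + (CPF ^+ 2)^-1) * (2 * CPF ^+ 2 * dt / nu P).
  by rewrite /cF /K; field; rewrite !gt_eqF ?ltr0n ?N_gt0.
have g0 : 0 <= 2 * CPF ^+ 2 * dt / nu P.
  by positivity.
rewrite cFE; set i := (CPF ^+ 2)^-1 in i0 *.
set a := _ / nu P in g0 *.
have p1 := mulr_ge0 g0 SF; have p2 := mulr_ge0 cP0 SP.
have p3 := mulr_ge0 (ltW cI_gt0) SB.
move: (\sum_(0 <= n < J.+1) F n) (\sum_(0 <= n < J.+1) Pf 0)
  (\sum_(0 <= n < J.+1) BB 0) p1 p2 p3 => s1 s2 s3 p1 p2 p3.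
have := mulr_ge0 i0 p1; have := mulr_ge0 i0 p2; have := mulr_ge0 i0 p3; have := mulr_ge0 i0 x0.
lra.
Qed.

(** * The whole interval *)

(** The old pressure enters the fine steps through its trace on the interface,
    which costs [h^-1]; pairing it against the penalty term, of the same order
    in [h], gives a bound that is uniform in the mesh size. *)
Lemma within_block k i : (k < M)%N -> (k * r <= i < k.+1 * r)%N ->
  x i <= expR (Chat * T) * (x (k * r)%N
    + 2 * K * dt / nu P * (\sum_(k * r <= n < k.+1 * r) F n)
    + ds * (2 * Cinv ^+ 2 / (rho P * gamma P)) * Pf k
    + gamma P * ds / (rho P * h) * BB k).
Proof.
move=> kM ik; have [nu0 _ rho0 gamma0 _] := pos_params; have dt0 := dt_gt0.
pose cF := 2 * K * dt / nu P.
have cF0 : 0 <= cF by rewrite /cF; positivity.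
pose q := 2 * Cinv ^+ 2 / (rho P * gamma P).
have q0 : 0 <= q by rewrite /q; positivity.
pose Y n := cF * F n + (dt * q * Pf k + cI * BB k).
have Y0 n : 0 <= Y n.
  have cI0 := ltW cI_gt0.
  by rewrite /Y; positivity.
have st n : (k * r <= n < k.+1 * r)%N -> x n.+1 + 0 <= (1 + Chat * dt) * x n + Y n.
  move=> nk; have nN := block_lt kM (proj2 (andP nk)).
  have h1 := fine_step (divr_gt0 nu0 (ltr0Sn R 1)) kM nk.
  (* The weight absorbs the normal trace of the velocity into half of the
     penalty term. *)
  have e0 : 0 < 2 * h / gamma P by rewrite divr_gt0// mulr_gt0.
  have h2 := phia_young e0 (ltnW kM) nN.
  have h4 : dt / rho P * phia k n <= dt * q * Pf k + cI / 2 * AA n.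
    have := ler_wpM2l (ltW (divr_gt0 dt0 rho0)) h2.
    move/le_trans; apply; rewrite le_eqVlt; apply/orP; left; apply/eqP.
    by rewrite /q /cI; field; rewrite !gt_eqF ?ltr0n ?N_gt0.
  have h5 : dt * (nu P / 2 * G n + K / (nu P / 2) * F n) =
      nu P * dt / 2 * G n + cF * F n.
    by rewrite /cF; field; rewrite !gt_eqF ?ltr0n ?N_gt0.
  have nd0 : 0 <= nu P * dt by rewrite mulr_ge0// ltW.
  have := mulr_ge0 nd0 (sqG n); have := mulr_ge0 cT_ge0 (sqTn n).
  have := mulr_ge0 (ltW cI_gt0) (sqAB k n).
  have := mulr_ge0 (ltW cI_gt0) (sqAA n).
  rewrite /Y; move: h1; rewrite h5; lra.
have [j -> jr] := in_block ik.
have := @discrete_gronwall _ _ x (fun=> 0) Y (k * r) j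
  (mulr_ge0 Chat_ge0 (ltW dt0)) (fun n _ => conj (lexx 0) (Y0 n)).
move=> /(_ (fun n nj => st n (block_in jr nj))); rewrite big1_eq addr0.
move/le_trans; apply.
have Sle : \sum_(k * r <= n < k * r + j) Y n <= \sum_(k * r <= n < k.+1 * r) Y n.
  rewrite (@big_cat_nat _ _ _ (k * r + j) (k * r) (k.+1 * r))/=;
    [|exact: leq_addr|by rewrite mulSn addnC leq_add2r ltnW].
  by rewrite lerDl sumr_ge0.
have SY0 : 0 <= x (k * r)%N + \sum_(k * r <= n < k.+1 * r) Y n.
  by rewrite addr_ge0 ?sqr_ge0// sumr_ge0.
have hL := ler_wpM2r SY0 (growth_le (leq_trans (ltnW jr) r_le_N)).
apply: le_trans (le_trans _ hL) _.
  apply: ler_wpM2l; last by rewrite lerD2l.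
  by rewrite exprn_ge0// addr_ge0// mulr_ge0// ltW.
rewrite ler_wpM2l ?expR_ge0//.
have -> : \sum_(k * r <= n < k.+1 * r) Y n =
    cF * (\sum_(k * r <= n < k.+1 * r) F n) +
    r%:R * (dt * q * Pf k + cI * BB k).
  by rewrite mulr_sumr big_split/= sumr_const_nat mulSn addnK mulr_natl.
rewrite -dt_ds le_eqVlt; apply/orP; left; apply/eqP.
by rewrite /cF /q /cI; ring.
Qed.

(** The contribution of a fine step to the penalty term of the
    microfracture step, up to a factor. *)
Let jp k n := ip (surface g) I
  (fun x => mdot ((uc w n.+1).1 x - (uf w k).1 x) (nd g))
  (fun x => mdot ((uf w k).1 x) (nd g)).

Lemma jump_polar k n : (k <= M)%N -> (n < N)%N ->
  2 * jp k n = AA n - BB k - AB k n.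
Proof.
move=> kM nN; have mI := measurable_interface g.
have SI := ip_semi_inner (surface g) mI.
pose a y := mdot ((uc w n.+1).1 y) (nd g); pose b y := mdot ((uf w k).1 y) (nd g).
have aL : L2 (surface g) I a by apply: L2_mdot => //; exact: uc_L2I.
have bL : L2 (surface g) I b by apply: L2_mdot => //; exact: uf_L2I.
rewrite /jp /AA /BB /AB !normI_sqr.
rewrite (_ : (fun y => mdot ((uc w n.+1).1 y - (uf w k).1 y) (nd g)) = a - b);
  last by apply/funext => y; rewrite mdotBl.
by rewrite (si_sub SI aL bL) (siBl SI aL bL bL) -/a -/b; ring.
Qed.

Lemma jump_young k l n : (k <= M)%N -> (l <= M)%N -> (n < N)%N ->
  phia k n - phib k l <=
  2 * Cinv ^+ 2 / gamma P * Pf k + gamma P / (2 * h) * AB l n.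
Proof.
move=> kM lM nN; have [_ _ _ gamma0 _] := pos_params.
have mI := measurable_interface g.
have SI := ip_semi_inner (surface g) mI.
pose a y := mdot ((uc w n.+1).1 y) (nd g); pose b y := mdot ((uf w l).1 y) (nd g).
have aL : L2 (surface g) I a by apply: L2_mdot => //; exact: uc_L2I.
have bL : L2 (surface g) I b by apply: L2_mdot => //; exact: uf_L2I.
have pL := phif_L2I kM.
have e0 : 0 < 2 * h / gamma P by rewrite divr_gt0// mulr_gt0.
rewrite /phia /phib /AB normI_sqr.
rewrite (_ : (fun y => mdot ((uc w n.+1).1 y - (uf w l).1 y) (nd g)) = a - b);
  last by apply/funext => y; rewrite mdotBl.
have -> : 2 * ip (surface g) I (phif w k) a - 2 * ip (surface g) I (phif w k) b =
    2 * ip (surface g) I (phif w k) (a - b).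
  by rewrite !(si_sym SI (phif w k)) (siBl SI aL bL pL); ring.
apply: le_trans (si_young SI e0 pL (siB SI aL bL)) _.
have hp := phi_interface_sqr h_gt0 Cinv_ok (phif_fe kM).
apply: le_trans (lerD (ler_wpM2l (ltW e0) hp) (lexx _)) _.
rewrite le_eqVlt; apply/orP; left; apply/eqP; rewrite -/(Pf k).
by field; rewrite !gt_eqF.
Qed.

Let cds := gamma P * ds / (rho P * h).

(** Energy balance of the conduit over one coarse step. The terms in [jp] and
    [phib] cancel against the interface terms of the microfracture step. *)
Lemma block_velocity k : (k < M)%N ->
  x (k.+1 * r)%N - x (k * r)%N
  + nu P * dt * (\sum_(k * r <= n < k.+1 * r) G n)
  + cT * (\sum_(k * r <= n < k.+1 * r) Tn n)
  + cI / 2 * (\sum_(k * r <= n < k.+1 * r) AB k.+1 n)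
  <= Chat * dt * (\sum_(k * r <= n < k.+1 * r) x n)
     + K * dt / nu P * (\sum_(k * r <= n < k.+1 * r) F n)
     + ds / rho P * phib k k.+1
     + ds * (2 * Cinv ^+ 2 / (rho P * gamma P)) * Pf k
     + cds * (BB k - BB k.+1)
     - 2 * cI * (\sum_(k * r <= n < k.+1 * r) jp k.+1 n).
Proof.
move=> kM; have [nu0 _ rho0 gamma0 _] := pos_params; have dt0 := dt_gt0.
pose q := 2 * Cinv ^+ 2 / (rho P * gamma P).
pose E := dt / rho P * phib k k.+1 + dt * q * Pf k + cI * (BB k - BB k.+1).
pose D n := nu P * dt * G n + cT * Tn n + cI / 2 * AB k.+1 n.
pose Y n := Chat * dt * x n + K * dt / nu P * F n + E - 2 * cI * jp k.+1 n.
have st n : (k * r <= n < k.+1 * r)%N -> x n.+1 - x n + D n <= Y n.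
  move=> nk; have nN := block_lt kM (proj2 (andP nk)).
  have h1 := fine_step nu0 kM nk.
  have h2 := jump_young (ltnW kM) kM nN.
  have h3 := jump_polar kM nN.
  have h4 : dt / rho P * phia k n <= dt / rho P * phib k k.+1 +
      dt * q * Pf k + cI / 2 * AB k.+1 n.
    have := ler_wpM2l (ltW (divr_gt0 dt0 rho0)) h2.
    rewrite mulrBr lerBlDl.
    have -> : dt / rho P * (2 * Cinv ^+ 2 / gamma P * Pf k +
      gamma P / (2 * h) * AB k.+1 n) = dt * q * Pf k + cI / 2 * AB k.+1 n.
      by rewrite /q /cI; field; rewrite !gt_eqF ?ltr0n ?N_gt0.
    by rewrite addrA.
  have h5 : dt * (nu P * G n + K / nu P * F n) =
      nu P * dt * G n + K * dt / nu P * F n by ring.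
  have h6 := mulr_ge0 (ltW cI_gt0) (sqAB k n).
  have h7 : AA n = 2 * jp k.+1 n + AB k.+1 n + BB k.+1.
    by rewrite h3 !subrK.
  rewrite /D /Y /E; move: h1 h4 h6; rewrite h5 h7 {D Y E}.
  move: (x n.+1) (x n) (G n) (Tn n) (AB k n) (AB k.+1 n) (BB k) (BB k.+1)
    (jp k.+1 n) (phia k n) (phib k k.+1) (Pf k) (F n) cI cT q K.
  by move=> *; lra.
have : \sum_(k * r <= n < k.+1 * r) (x n.+1 - x n + D n) <=
    \sum_(k * r <= n < k.+1 * r) Y n by exact: ler_sum_nat.
rewrite big_split/= telescope_sumr; last by rewrite leq_mul2r leqnSn orbT.
have -> : \sum_(k * r <= n < k.+1 * r) D n =
    nu P * dt * (\sum_(k * r <= n < k.+1 * r) G n)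
    + cT * (\sum_(k * r <= n < k.+1 * r) Tn n)
    + cI / 2 * (\sum_(k * r <= n < k.+1 * r) AB k.+1 n).
  by rewrite !mulr_sumr -!big_split.
have -> : \sum_(k * r <= n < k.+1 * r) Y n =
    Chat * dt * (\sum_(k * r <= n < k.+1 * r) x n)
    + K * dt / nu P * (\sum_(k * r <= n < k.+1 * r) F n) + r%:R * E
    - 2 * cI * (\sum_(k * r <= n < k.+1 * r) jp k.+1 n).
  rewrite sumrB big_split/= big_split/= sumr_const_nat mulSn addnK.
  by rewrite (mulr_natl E) !mulr_sumr.
have -> : r%:R * E = ds / rho P * phib k k.+1 + ds * q * Pf k
    + cds * (BB k - BB k.+1).
  by rewrite /E /cds -dt_ds /cI; ring.
rewrite !addrA; exact.
Qed.

Let em := etam P * Cmt P / rho P.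
Let ef := etaf P * Cft P / rho P.
Let sg := sigma P * km P * ds / (rho P * mu P).
Let dPm k := normd g (phim w k.+1 - phim w k) ^+ 2.
Let dPf k := normd g (phif w k.+1 - phif w k) ^+ 2.
Let dPmf k := normd g (phim w k.+1 - phif w k) ^+ 2.
Let dPfm k := normd g (phif w k.+1 - phim w k) ^+ 2.
Let Um k := normdv g (um w k.+1).1 ^+ 2.
Let Uf k := normdv g (uf w k.+1).1 ^+ 2.
Let Fd k := normd g (fd (k.+1%:R * ds)) ^+ 2.

(** The energy after [k] coarse steps, and the dissipation of a coarse step. *)
Let En k := x (k * r)%N + cds * BB k + em * Pm k + ef * Pf k + sg * (Pm k + Pf k).
Let Di k := nu P * dt * (\sum_(k * r <= n < k.+1 * r) G n)
  + cT * (\sum_(k * r <= n < k.+1 * r) Tn n)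
  + 2 * mu P * ds / (rho P * km P) * Um k
  + cI / 2 * (\sum_(k * r <= n < k.+1 * r) AB k.+1 n)
  + 2 * mu P * ds / (rho P * kf P) * Uf k
  + em * dPm k + ef / 2 * dPf k + sg * (dPmf k + dPfm k).

Lemma coarse_energy k : (k < M)%N ->
  En k.+1 + Di k <= En k
     + Chat * dt * (\sum_(k * r <= n < k.+1 * r) x n)
     + K * dt / nu P * (\sum_(k * r <= n < k.+1 * r) F n)
     + ds * (2 * Cinv ^+ 2 / (rho P * gamma P)) * Pf k
     + (2 * ds + 1) * (ds / (rho P * (etaf P * Cft P))) * Fd k
     + ds * ef * Pf k.
Proof.
move=> kM; have [nu0 mu0 rho0 gamma0 sigma0] := pos_params.
have [_ cf0 _ _ _] := pos_coefs; have ds0 := ds_gt0; have kM' := ltnW kM.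
have [Yf Qf st3] := solution_f w_sol kM; have [Ym Qm st2] := solution_m w_sol kM.
have h1 := block_velocity kM.
have h2 := step2_energy g_ok P_gt0 ds0 (phif_L2 kM') (phim_L2 kM') (phim_L2 kM)
  (um_L2 kM) Ym Qm st2.
have h3 := step3_energy g_ok P_gt0 h_gt0 ds0 (phif_L2 kM') (phim_L2 kM')
  (phif_L2 kM) (uf_L2 kM) Yf Qf st3.
have uL n : (k * r <= n < k.+1 * r)%N -> L2mx (surface g) I (uc w n.+1).1.
  by move=> nk; apply: uc_L2I; exact: block_lt kM (proj2 (andP nk)).
have h4 := average_interface r_gt0 uL (uf_L2I kM).
have h5 : gamma P * ds / (rho P * h) *
      (2 * ip (surface g) I
        (fun y => mdot (r%:R^-1 *: (\sum_(k * r <= n < k.+1 * r) (uc w n.+1).1 y)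
           - (uf w k.+1).1 y) (nd g))
        (fun y => mdot ((uf w k.+1).1 y) (nd g))) =
    2 * cI * (\sum_(k * r <= n < k.+1 * r) jp k.+1 n).
  by rewrite -h4 -dt_ds /cI; ring.
(* The source is tested against the new pressure, which is split into the old
   one and the increment, so that the bound stays explicit. *)
have SI := ip_semi_inner leb (measurable_Omd g_ok).
have fL := fd_L2 kM; have pL := phif_L2 kM'; have pL' := phif_L2 kM.
have h6 : 2 * ip leb (Omd g) (fd (k.+1%:R * ds)) (phif w k.+1) =
    2 * ip leb (Omd g) (fd (k.+1%:R * ds)) (phif w k.+1 - phif w k) +
    2 * ip leb (Omd g) (fd (k.+1%:R * ds)) (phif w k).
  by rewrite !(si_sym SI (fd _)) (siBl SI pL' pL fL); ring.
have e1 : 0 < 2 * ds / (etaf P * Cft P) by rewrite divr_gt0// mulr_gt0.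
have e2 : 0 < (etaf P * Cft P)^-1 by rewrite invr_gt0.
have h7 := si_young SI e1 fL (siB SI pL' pL).
have h8 := si_young SI e2 fL pL.
rewrite -!(normd_sqr g_ok) in h7 h8.
have h9 : ds / rho P * (2 * ip leb (Omd g) (fd (k.+1%:R * ds)) (phif w k.+1)) <=
    (2 * ds + 1) * (ds / (rho P * (etaf P * Cft P))) * Fd k + ef / 2 * dPf k
    + ds * ef * Pf k.
  rewrite h6; apply: le_trans (ler_wpM2l (ltW (divr_gt0 ds0 rho0)) (lerD h7 h8)) _.
  rewrite le_eqVlt; apply/orP; left; apply/eqP.
  rewrite -/(Fd k) -/(dPf k) -/(Pf k) /ef; field.
  have [etaf0 Cft0] : etaf P != 0 /\ Cft P != 0.
    by apply/andP; rewrite -negb_or -mulf_eq0 gt_eqF.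
  by rewrite etaf0 Cft0 !gt_eqF ?ltr0n.
move: h3; rewrite h5 => h3.
rewrite /En /Di; move: h1 h2 h3 h9.
rewrite -/(Pf k) -/(Pf k.+1) -/(Pm k) -/(Pm k.+1) -/em -/ef -/sg.
rewrite -/(dPm k) -/(dPf k) -/(dPmf k) -/(dPfm k) -/(Um k) -/(Uf k).
rewrite -/(phib k k.+1).
move: (\sum_(_ <= n < _) x n) (\sum_(_ <= n < _) F n) (\sum_(_ <= n < _) G n)
  (\sum_(_ <= n < _) Tn n) (\sum_(_ <= n < _) AB _ n) (\sum_(_ <= n < _) jp _ n).
move: (x (k.+1 * r)%N) (x (k * r)%N) (BB k) (BB k.+1) (Pf k) (Pf k.+1) (Pm k)
  (Pm k.+1) (dPm k) (dPf k) (dPmf k) (dPfm k) (Um k) (Uf k) (Fd k) (phib k k.+1)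
  em ef sg cT cI cds K => *; lra.
Qed.

(** Constants of the Gronwall argument; [rate] and [load] depend neither on the
    mesh size nor on the time steps. *)
Let L := expR (Chat * T).
Let q := 2 * Cinv ^+ 2 / (gamma P * (etaf P * Cft P)).
Let i2 := (CPF ^+ 2)^-1.
Let g1 := CPF ^+ 2 * dt / nu P.
Let g2 := 2 * dt / (rho P * etaf P * Cft P).
Let rate := Chat * L * (1 + T * q) + 1 + q.
Let load := (1 + 2 * Chat * T * L) * (1 + i2) + T + 1.

(** The contribution of the sources to a coarse step. *)
Let data k := g1 * (\sum_(k * r <= n < k.+1 * r) F n)
  + g2 * (\sum_(k * r <= n < k.+1 * r) Fd k).

Let cds_ge0 : 0 <= cds.
Proof.
have [nu0 mu0 rho0 gamma0 sigma0] := pos_params; have ds0 := ds_gt0.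
by rewrite /cds; positivity.
Qed.

Let coefs_ge0 : [/\ 0 <= em, 0 <= ef, 0 <= sg, 0 <= q & 0 <= i2].
Proof.
have [nu0 mu0 rho0 gamma0 sigma0] := pos_params; have ds0 := ds_gt0.
have [_ cf0 cm0 _ km0] := pos_coefs.
by split; rewrite /em /ef /sg /q /i2 ?invr_ge0; positivity.
Qed.

Let g_ge0 : 0 <= g1 /\ 0 <= g2.
Proof.
have [nu0 _ rho0 _ _] := pos_params; have dt0 := dt_gt0.
have [_ cf0 _ _ _] := pos_coefs.
by rewrite /g1 /g2 -[rho P * _ * _]mulrA; split; positivity.
Qed.

Let Fsum_ge0 k : 0 <= \sum_(k * r <= n < k.+1 * r) F n.
Proof. exact: sumr_ge0. Qed.

Let sqFd k : 0 <= Fd k. Proof. exact: sqr_ge0. Qed.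

Let data_ge0 k : 0 <= data k.
Proof.
have [? ?] := g_ge0; have ? := Fsum_ge0 k.
have ? : 0 <= \sum_(k * r <= n < k.+1 * r) Fd k by exact: sumr_ge0.
by rewrite /data; positivity.
Qed.

Let rate_ge0 : 0 <= rate.
Proof.
have [_ _ _ q0 _] := coefs_ge0; have L0 : 0 <= L := expR_ge0 _.
by rewrite /rate; positivity.
Qed.

Let load_ge0 : 0 <= load.
Proof.
have [_ _ _ _ i0] := coefs_ge0; have L0 : 0 <= L := expR_ge0 _.
by rewrite /load; positivity.
Qed.

(** The growth produced by the characteristics during a coarse step, in terms of
    the energy at its beginning and the body force. *)
Lemma block_mass k : (k < M)%N ->
  Chat * dt * (\sum_(k * r <= n < k.+1 * r) x n) <=
  Chat * ds * (L * (x (k * r)%N + cds * BB k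
    + 2 * (1 + i2) * (g1 * (\sum_(k * r <= n < k.+1 * r) F n))
    + ds * q * (ef * Pf k))).
Proof.
move=> kM; have [nu0 mu0 rho0 gamma0 sigma0] := pos_params.
have [_ cf0 _ _ _] := pos_coefs; have dt0 := dt_gt0.
set b := L * _.
have xb n : (k * r <= n < k.+1 * r)%N -> x n <= b.
  move=> nk; apply: le_trans (within_block kM nk) _.
  rewrite le_eqVlt; apply/orP; left; apply/eqP; rewrite /b -/L.
  congr (_ * _); rewrite /K /g1 /i2 /cds /q /ef; field.
  have [etaf0 Cft0] : etaf P != 0 /\ Cft P != 0.
    by apply/andP; rewrite -negb_or -mulf_eq0 gt_eqF.
  by rewrite etaf0 Cft0 !gt_eqF ?ltr0n ?N_gt0.
have -> : Chat * ds * b = Chat * dt * (r%:R * b).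
  by rewrite -[in LHS]dt_ds; ring.
apply: ler_wpM2l; first by positivity.
apply: le_trans (ler_sum_nat xb) _.
by rewrite sumr_const_nat mulSn addnK mulr_natl.
Qed.

Lemma energy_growth k : (k < M)%N ->
  En k.+1 + Di k <= (1 + rate * ds) * En k + load * data k.
Proof.
move=> kM; have [nu0 mu0 rho0 gamma0 sigma0] := pos_params.
have [_ cf0 cm0 _ km0] := pos_coefs; have ds0 := ltW ds_gt0.
have [em0 ef0 sg0 q0 i0] := coefs_ge0; have [g10 g20] := g_ge0.
have dt0 := dt_gt0; have L0 : 0 <= L := expR_ge0 _.
have sF0 := Fsum_ge0 k.
apply: le_trans (coarse_energy kM) _.
have h1 := block_mass kM.
have [etaf0 Cft0] : etaf P != 0 /\ Cft P != 0.
  by apply/andP; rewrite -negb_or -mulf_eq0 gt_eqF.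
have e1 : K * dt / nu P = (1 + i2) * g1.
  by rewrite /K /g1 /i2; field; rewrite !gt_eqF ?ltr0n ?N_gt0.
have e2 : 2 * Cinv ^+ 2 / (rho P * gamma P) = q * ef.
  by rewrite /q /ef; field; rewrite etaf0 Cft0 !gt_eqF.
have e3 : (2 * ds + 1) * (ds / (rho P * (etaf P * Cft P))) * Fd k =
    (ds + 1 / 2) * (g2 * (\sum_(k * r <= n < k.+1 * r) Fd k)).
  rewrite sumr_const_nat mulSn addnK -(mulr_natl (Fd k)) /g2.
  rewrite -[in X in _ * (X / _) * _]dt_ds.
  by field; rewrite etaf0 Cft0 !gt_eqF ?ltr0n ?N_gt0.
have p0 : 0 <= ef * Pf k by rewrite mulr_ge0.
have u0 : 0 <= x (k * r)%N + cds * BB k.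
  by rewrite addr_ge0 ?sqr_ge0// mulr_ge0.
have [ue pe e0] : [/\ x (k * r)%N + cds * BB k <= En k, ef * Pf k <= En k &
    0 <= En k].
  have m0 : 0 <= em * Pm k by rewrite mulr_ge0.
  have s0 : 0 <= sg * (Pm k + Pf k) by rewrite mulr_ge0 ?addr_ge0.
  rewrite /En; move: u0 p0 m0 s0.
  move: (x _ + _) (em * _) (ef * _) (sg * _) => u m p s *.
  by split; lra.
have v0 : 0 <= g2 * (\sum_(k * r <= n < k.+1 * r) Fd k).
  by rewrite mulr_ge0// sumr_ge0.
have f0 : 0 <= g1 * (\sum_(k * r <= n < k.+1 * r) F n) by rewrite mulr_ge0.
have sT := ds_le_T; have T0 := ltW T_gt0.
move: h1; rewrite e1 e2 e3 /data /rate /load.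
rewrite -[(1 + i2) * g1 * _]mulrA.
rewrite -[ds * (q * ef) * Pf k]mulrA -[q * ef * Pf k]mulrA.
rewrite -[ds * ef * Pf k]mulrA.
move: ds0 sT f0 v0 e0 ue pe u0 p0.
move: (g1 * _) (g2 * _) (En k) (ef * Pf k) (x (k * r)%N + cds * BB k)
  (Chat * dt * _) => f v e p u X0.
move: ds => s s0 sT f0 v0 e0 ue pe u0 p0 h1.
have b1 : s * q * p <= T * q * e.
  by apply: ler_pM; [positivity| |apply: ler_wpM2r|].
have b2 : Chat * s * L * (u + s * q * p) <= Chat * s * L * ((1 + T * q) * e).
  apply: ler_wpM2l; first by positivity.
  by rewrite mulrDl mul1r lerD.
have b3 : Chat * s * L * (2 * (1 + i2) * f) <= Chat * T * L * (2 * (1 + i2) * f).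
  apply: ler_wpM2r; first by positivity.
  by apply: ler_wpM2r => //; exact: ler_wpM2l.
have b4 : s * (q * p) <= s * (q * e) by rewrite !ler_wpM2l.
have b5 : s * p <= s * e by rewrite ler_wpM2l.
have b6 : (s + 1 / 2) * v <= (T + 1) * v by apply: ler_wpM2r => //; lra.
have b7 : 0 <= ((1 + 2 * Chat * T * L) * (1 + i2)) * v by positivity.
have b8 : 0 <= (T + 1) * f by positivity.
lra.
Qed.

Lemma whole_interval :
  x N
  + nu P * dt * (\sum_(0 <= k < M) \sum_(k * r <= n < k.+1 * r) G n)
  + cT * (\sum_(0 <= k < M) \sum_(k * r <= n < k.+1 * r) Tn n)
  + 2 * mu P * ds / (rho P * km P) * (\sum_(0 <= k < M) Um k)
  + gamma P * dt / (2 * rho P * h) *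
      (\sum_(0 <= k < M) \sum_(k * r <= n < k.+1 * r) AB k.+1 n)
  + cds * BB M
  + 2 * mu P * ds / (rho P * kf P) * (\sum_(0 <= k < M) Uf k)
  + em * (Pm M + \sum_(0 <= k < M) dPm k)
  + ef * (Pf M + \sum_(0 <= k < M) dPf k)
  + sg * (Pm M + \sum_(0 <= k < M) dPmf k + Pf M + \sum_(0 <= k < M) dPfm k)
  <= 2 * expR (rate * T) * (1 + load) *
     (g1 * (\sum_(0 <= k < M) \sum_(k * r <= n < k.+1 * r) F n)
      + g2 * (\sum_(0 <= k < M) \sum_(k * r <= n < k.+1 * r) Fd k)
      + cds * BB 0 + x 0 + em * Pm 0 + ef * Pf 0 + sg * (Pm 0 + Pf 0)).
Proof.
have [nu0 mu0 rho0 gamma0 sigma0] := pos_params.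
have [_ cf0 cm0 kf0 km0] := pos_coefs; have ds0 := ltW ds_gt0.
have [em0 ef0 sg0 q0 i0] := coefs_ge0; have dt0 := dt_gt0.
have En0 k : 0 <= En k.
  have := sqBB k; have := sqPm k; have := sqPf k => ? ? ?.
  have ? : 0 <= x (k * r)%N by exact: sqr_ge0.
  by rewrite /En; positivity.
have cI2 : 0 <= cI / 2 by rewrite divr_ge0// ltW.
have sqUm k : 0 <= Um k by exact: sqr_ge0.
have sqUf k : 0 <= Uf k by exact: sqr_ge0.
have sq1 k : 0 <= dPm k by exact: sqr_ge0.
have sq2 k : 0 <= dPf k by exact: sqr_ge0.
have sq3 k : 0 <= dPmf k by exact: sqr_ge0.
have sq4 k : 0 <= dPfm k by exact: sqr_ge0.
have SG : 0 <= \sum_(0 <= k < M) \sum_(k * r <= n < k.+1 * r) G n.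
  by apply: sumr_ge0 => k _; exact: sumr_ge0.
have ST : 0 <= \sum_(0 <= k < M) \sum_(k * r <= n < k.+1 * r) Tn n.
  by apply: sumr_ge0 => k _; exact: sumr_ge0.
have SA : 0 <= \sum_(0 <= k < M) \sum_(k * r <= n < k.+1 * r) AB k.+1 n.
  by apply: sumr_ge0 => k _; exact: sumr_ge0.
have Di0 k : 0 <= Di k.
  have ? : 0 <= \sum_(k * r <= n < k.+1 * r) G n by exact: sumr_ge0.
  have ? : 0 <= \sum_(k * r <= n < k.+1 * r) Tn n by exact: sumr_ge0.
  have ? : 0 <= \sum_(k * r <= n < k.+1 * r) AB k.+1 n by exact: sumr_ge0.
  have := sqUm k; have := sqUf k; have := sq1 k => ? ? ?.
  have := sq2 k; have := sq3 k; have := sq4 k => ? ? ?.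
  by rewrite /Di; positivity.
have rds : 0 <= rate * ds by rewrite mulr_ge0.
have gron := discrete_gronwall rds
  (fun k _ => conj (Di0 k) (mulr_ge0 load_ge0 (data_ge0 k)))
  (fun k (kM : (0 <= k < 0 + M)%N) => energy_growth (proj2 (andP kM))).
have SY0 : 0 <= En 0 + \sum_(0 <= k < M) load * data k.
  by rewrite addr_ge0// sumr_ge0// => k _; rewrite mulr_ge0.
have grow : (1 + rate * ds) ^+ M <= expR (rate * T).
  apply: (@le_trans _ _ (expR (rate * ds) ^+ M)).
    by apply: lerXn2r; rewrite ?nnegrE ?expR_ge0 ?expR_ge1Dx// addr_ge0.
  have M0 : M%:R != 0 :> R by rewrite pnatr_eq0 -lt0n.
  by rewrite -expRM_natl ler_expR mulrCA [M%:R * _]mulrC divfK.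
have DiE : \sum_(0 <= k < M) Di k =
    nu P * dt * (\sum_(0 <= k < M) \sum_(k * r <= n < k.+1 * r) G n)
    + cT * (\sum_(0 <= k < M) \sum_(k * r <= n < k.+1 * r) Tn n)
    + 2 * mu P * ds / (rho P * km P) * (\sum_(0 <= k < M) Um k)
    + cI / 2 * (\sum_(0 <= k < M) \sum_(k * r <= n < k.+1 * r) AB k.+1 n)
    + 2 * mu P * ds / (rho P * kf P) * (\sum_(0 <= k < M) Uf k)
    + em * (\sum_(0 <= k < M) dPm k) + ef / 2 * (\sum_(0 <= k < M) dPf k)
    + sg * (\sum_(0 <= k < M) dPmf k + \sum_(0 <= k < M) dPfm k).
  by rewrite -big_split/= !mulr_sumr -!big_split.
have dataE : \sum_(0 <= k < M) load * data k = load *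
    (g1 * (\sum_(0 <= k < M) \sum_(k * r <= n < k.+1 * r) F n)
     + g2 * (\sum_(0 <= k < M) \sum_(k * r <= n < k.+1 * r) Fd k)).
  by rewrite -mulr_sumr !mulr_sumr -!big_split -mulr_sumr.
have data0 : 0 <= g1 * (\sum_(0 <= k < M) \sum_(k * r <= n < k.+1 * r) F n)
     + g2 * (\sum_(0 <= k < M) \sum_(k * r <= n < k.+1 * r) Fd k).
  have [? ?] := g_ge0.
  by apply: addr_ge0; apply: mulr_ge0 => //; apply: sumr_ge0 => k _; exact: sumr_ge0.
have EnM : En M = x N + cds * BB M + em * Pm M + ef * Pf M + sg * (Pm M + Pf M).
  by rewrite /En -(mulnC r) -NrM.
have En_0 : En 0 = x 0 + cds * BB 0 + em * Pm 0 + ef * Pf 0 + sg * (Pm 0 + Pf 0).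
  by rewrite /En mul0n.
have low : En M + \sum_(0 <= k < M) Di k <=
    expR (rate * T) * ((1 + load) *
     (g1 * (\sum_(0 <= k < M) \sum_(k * r <= n < k.+1 * r) F n)
      + g2 * (\sum_(0 <= k < M) \sum_(k * r <= n < k.+1 * r) Fd k) + En 0)).
  apply: le_trans gron _; apply: le_trans (ler_wpM2r SY0 grow) _.
  apply: ler_wpM2l; first exact: expR_ge0.
  have p1 := mulr_ge0 load_ge0 (En0 0).
  rewrite dataE; move: p1 data0.
  by move: (En 0) (g1 * _ + _) => e f *; lra.
have ciE : gamma P * dt / (2 * rho P * h) = cI / 2.
  by rewrite /cI; field; rewrite !gt_eqF ?ltr0n ?N_gt0.
(* The factor 2 restores the half of the pressure increments that absorbed the
   source. *)
rewrite ciE.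
apply: le_trans (_ : 2 * (En M + \sum_(0 <= k < M) Di k) <= _); last first.
  rewrite -[2 * _ * _]mulrA -mulrA ler_pM2l//; apply: le_trans low _.
  rewrite En_0 le_eqVlt; apply/orP; left; apply/eqP; rewrite -mulrA.
  by congr (_ * (_ * _)); ring.
rewrite EnM DiE.
have c0 : 0 <= nu P * dt by rewrite mulr_ge0// ltW.
have c1 : 0 <= 2 * mu P * ds / (rho P * km P) by positivity.
have c2 : 0 <= 2 * mu P * ds / (rho P * kf P) by positivity.
have t1 := mulr_ge0 c0 SG; have t2 := mulr_ge0 cT_ge0 ST.
have t3 := mulr_ge0 cI2 SA.
have t4 : 0 <= 2 * mu P * ds / (rho P * km P) * (\sum_(0 <= k < M) Um k).
  by rewrite mulr_ge0 ?sumr_ge0.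
have t5 : 0 <= 2 * mu P * ds / (rho P * kf P) * (\sum_(0 <= k < M) Uf k).
  by rewrite mulr_ge0 ?sumr_ge0.
have t6 : 0 <= em * (\sum_(0 <= k < M) dPm k) by rewrite mulr_ge0 ?sumr_ge0.
have t7 : 0 <= sg * (\sum_(0 <= k < M) dPmf k + \sum_(0 <= k < M) dPfm k).
  by rewrite mulr_ge0 ?addr_ge0 ?sumr_ge0.
have t8 := En0 M; rewrite EnM in t8.
have x0 : 0 <= x N by exact: sqr_ge0.
move: t1 t2 t3 t4 t5 t6 t7 t8 x0.
move: (\sum_(0 <= k < M) dPf k) (\sum_(0 <= k < M) dPmf k)
  (\sum_(0 <= k < M) dPfm k) (\sum_(0 <= k < M) dPm k).
move: (nu P * dt * _) (cT * _) (cI / 2 * _) (_ * \sum_(_ <= k < _) Um k)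
  (_ * \sum_(_ <= k < _) Uf k) (x N) (cds * BB M) (Pm M) (Pf M).
by move=> *; lra.
Qed.

End run.

Theorem theorem3p1 (R : realType) (d : nat) (d12 : d = 1%N \/ d = 2%N)
    (g : geometry R d) (g_ok : is_geometry g)
    (P : params R) (P_gt0 : positive_params P)
    (T CPF CT Cinv Chat kappa chic chif chim : R)
    (T_gt0 : 0 < T) (CPF_gt0 : 0 < CPF) (CT_gt0 : 0 < CT)
    (Cinv_gt0 : 0 < Cinv) (Chat_ge0 : 0 <= Chat) (kappa_gt0 : 0 < kappa)
    (chic_gt0 : 0 < chic) (chif_gt0 : 0 < chif) (chim_gt0 : 0 < chim)
    (CPF_ok : poincare_friedrichs g CPF) (CT_ok : trace_inequality g CT) :
  exists C : R, 0 < C /\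
  forall (N M r : nat) (M_gt0 : (0 < M)%N) (r_gt0 : (0 < r)%N)
    (NrM : N = (r * M)%N)
    (h : R) (Th : seq (simplex R d)) (Th_ok : is_mesh g kappa Th h)
    (S : fe_spaces R d) (S_ok : is_fe_spaces g Th chic chif chim S)
    (Cinv_ok : inverse_trace_inequality g Cinv h (Qfh S))
    (Ph : projections R d) (Ph_ok : is_projections g S Ph)
    (fc : R -> H1fun R d -> R) (fc_ok : L2Hm1 g T fc)
    (fd : R -> 'rV[R]_d.+1 -> R) (fd_ok : L2L2 g T fd)
    (uc0 : H1fun R d) (uc0_ok : Yc g uc0)
    (phim0 phif0 : 'rV[R]_d.+1 -> R)
    (phim0_ok : L20 (Omd g) phim0) (phif0_ok : L20 (Omd g) phif0)
    (w : iterates R d) (w_initial : is_initial S Ph uc0 phim0 phif0 w),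
  let dt := T / N%:R in
  let ds := T / M%:R in
  is_solution g P S h dt ds M r fc fd w ->
  (forall n, (n < N)%N -> characteristic_bound g Chat dt (uc w n).1) ->
  Chat * dt < 1 ->
  (forall J, (J < r)%N ->
     normc g (uc w J.+1).1 ^+ 2
     + nu P * dt / 2 * (\sum_(0 <= n < J.+1) normc g (uc w n.+1).2 ^+ 2)
     + 2 * alpha P * nu P * dt / Num.sqrt (kf P) *
         (\sum_(0 <= n < J.+1)
            normIv g (fun x => Ptau g ((uc w n.+1).1 x)) ^+ 2)
     + gamma P * dt / (rho P * h) *
         (\sum_(0 <= n < J.+1)
            normI g (fun x =>
              mdot ((uc w n.+1).1 x - (uf w 0).1 x) (nd g)) ^+ 2)
     + gamma P * dt / (rho P * h) *
         (\sum_(0 <= n < J.+1)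
            normI g (fun x => mdot ((uc w n.+1).1 x) (nd g)) ^+ 2)
     <= C * (2 * CPF ^+ 2 * dt / nu P *
               (\sum_(0 <= n < J.+1) Hm1norm g (fc (n.+1%:R * dt)) ^+ 2)
             + CT ^+ 2 * Cinv ^+ 2 * CPF * dt / (rho P ^+ 2 * nu P * h) *
               (\sum_(0 <= n < J.+1) normd g (phif w 0) ^+ 2)
             + gamma P * dt / (rho P * h) *
               (\sum_(0 <= n < J.+1)
                  normI g (fun x => mdot ((uf w 0).1 x) (nd g)) ^+ 2)
             + normc g (uc w 0).1 ^+ 2))
  /\
  (4 * Cinv ^+ 2 / (etaf P * Cft P) * (dt / (1 - dt - 2 * Chat * dt))
     <= gamma P ->
   normc g (uc w N).1 ^+ 2
   + nu P * dt * (\sum_(0 <= k < M) \sum_(k * r <= n < k.+1 * r)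
                    normc g (uc w n.+1).2 ^+ 2)
   + 2 * alpha P * nu P * dt / Num.sqrt (kf P) *
       (\sum_(0 <= k < M) \sum_(k * r <= n < k.+1 * r)
          normIv g (fun x => Ptau g ((uc w n.+1).1 x)) ^+ 2)
   + 2 * mu P * ds / (rho P * km P) *
       (\sum_(0 <= k < M) normdv g (um w k.+1).1 ^+ 2)
   + gamma P * dt / (2 * rho P * h) *
       (\sum_(0 <= k < M) \sum_(k * r <= n < k.+1 * r)
          normI g (fun x =>
            mdot ((uc w n.+1).1 x - (uf w k.+1).1 x) (nd g)) ^+ 2)
   + gamma P * ds / (rho P * h) *
       normI g (fun x => mdot ((uf w M).1 x) (nd g)) ^+ 2
   + 2 * mu P * ds / (rho P * kf P) *
       (\sum_(0 <= k < M) normdv g (uf w k.+1).1 ^+ 2)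
   + etam P * Cmt P / rho P *
       (normd g (phim w M) ^+ 2
        + \sum_(0 <= k < M) normd g (phim w k.+1 - phim w k) ^+ 2)
   + etaf P * Cft P / rho P *
       (normd g (phif w M) ^+ 2
        + \sum_(0 <= k < M) normd g (phif w k.+1 - phif w k) ^+ 2)
   + sigma P * km P * ds / (rho P * mu P) *
       (normd g (phim w M) ^+ 2
        + \sum_(0 <= k < M) normd g (phim w k.+1 - phif w k) ^+ 2
        + normd g (phif w M) ^+ 2
        + \sum_(0 <= k < M) normd g (phif w k.+1 - phim w k) ^+ 2)
   <= C * (CPF ^+ 2 * dt / nu P *
             (\sum_(0 <= k < M) \sum_(k * r <= n < k.+1 * r)
                Hm1norm g (fc (n.+1%:R * dt)) ^+ 2)
           + 2 * dt / (rho P * etaf P * Cft P) *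
             (\sum_(0 <= k < M) \sum_(k * r <= n < k.+1 * r)
                normd g (fd (k.+1%:R * ds)) ^+ 2)
           + gamma P * ds / (rho P * h) *
             normI g (fun x => mdot ((uf w 0).1 x) (nd g)) ^+ 2
           + normc g (uc w 0).1 ^+ 2
           + etam P * Cmt P / rho P * normd g (phim w 0) ^+ 2
           + etaf P * Cft P / rho P * normd g (phif w 0) ^+ 2
           + sigma P * km P * ds / (rho P * mu P) *
             (normd g (phim w 0) ^+ 2 + normd g (phif w 0) ^+ 2))).
Proof.
have [[nu0 mu0 sigma0 alpha0 rho0] [[etaf0 etam0 Cft0 Cmt0] [kf0 km0 gamma0]]] :=
  P_gt0.
pose L := expR (Chat * T).
pose q := 2 * Cinv ^+ 2 / (gamma P * (etaf P * Cft P)).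
pose rate := Chat * L * (1 + T * q) + 1 + q.
pose load := (1 + 2 * Chat * T * L) * (1 + (CPF ^+ 2)^-1) + T + 1.
pose C1 := L * (3 + (CPF ^+ 2)^-1).
pose C2 := 2 * expR (rate * T) * (1 + load).
have i0 : 0 <= (CPF ^+ 2)^-1 by rewrite invr_ge0 sqr_ge0.
have L0 : 0 <= L := expR_ge0 _.
have C10 : 0 < C1 by rewrite mulr_gt0 ?expR_gt0// ltr_pwDl.
have load0 : 0 <= load by rewrite /load; positivity.
have C20 : 0 < C2 by rewrite !mulr_gt0 ?expR_gt0// ltr_pwDl.
exists (C1 + C2); split; first exact: addr_gt0.
move=> N M r M_gt0 r_gt0 NrM h Th Th_ok S S_ok Cinv_ok Ph Ph_ok fc fc_ok fd fd_ok
  uc0 uc0_ok phim0 phif0 phim0_ok phif0_ok w w_initial dt ds w_sol w_char _.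
have h0 := mesh_size_gt0 Th_ok.
have dt0 : 0 <= dt by rewrite divr_ge0// ltW.
have ds0 : 0 <= ds by rewrite divr_ge0// ltW.
split=> [J Jr|_].
  apply: le_trans (first_interval g_ok P_gt0 T_gt0 CPF_gt0 CT_gt0 Chat_ge0 CPF_ok
    CT_ok M_gt0 r_gt0 NrM h0 S_ok Cinv_ok Ph_ok fc_ok uc0_ok phif0_ok w_initial
    w_sol w_char Jr) _.
  by apply: ler_wpM2r; [positivity; apply: sumr_ge0 => n _; exact: sqr_ge0|
    rewrite lerDl ltW].
apply: le_trans (whole_interval g_ok P_gt0 T_gt0 CPF_gt0 CT_gt0 Chat_ge0 CPF_ok
  M_gt0 r_gt0 NrM h0 S_ok Cinv_ok Ph_ok fc_ok fd_ok uc0_ok phim0_ok phif0_ok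
  w_initial w_sol w_char) _.
apply: ler_wpM2r; last by rewrite lerDr ltW.
by positivity; apply: sumr_ge0 => k _; apply: sumr_ge0 => n _; exact: sqr_ge0.
Qed.
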